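(* Let $k_n\ge 2$ be integers with $k_n\to\infty$ and let $\boldsymbol Z_n=(Z_{n,1},\dots,Z_{n,k_n})$, $Z_{n,i}=(X_{n,i},Y_{n,i})$ with $0<Y_{n,i}\le X_{n,i}$, be a triangular array of random vectors. Suppose that $\lim_{n\to\infty}\Pr(Z_{n,1}=\cdots=Z_{n,k_n})=0$, and that there exist $\rho\in\mathcal C$, $\alpha_0>0$, a sequence $(\sigma_n)_n\subset(0,\infty)$ and constants $0<\alpha_-<\alpha_1<\alpha_+<\infty$ with $\alpha_1=\varpi_{\rho_0}\alpha_0$, $\rho_0=\rho(0)$, such that, as $n\to\infty$, $$\frac1{k_n}\sum_{i=1}^{k_n} f\Big(\frac{X_{n,i}}{\sigma_n},\frac{Y_{n,i}}{\sigma_n}\Big)\rightsquigarrow\int_{(0,\infty)^2}f(x,y)\,\mathrm dH_{\rho,\alpha_0,1}(x,y)$$ for all $f\in\mathcal F_1(\alpha_-,\alpha_+)$. Let $\hat\rho_{0,n}$ be $[0,1]$-valued random variables with $\hat\rho_{0,n}\rightsquigarrow\rho_0$ as $n\to\infty$. With $(\hat\alpha_n,\hat\sigma_n)=\hat\theta(\boldsymbol Z_n)$ the maximum likelihood estimator, define $$\hat\varpi_n=\varpi_{\hat\rho_{0,n}},\qquad \widetilde\alpha_n=\hat\alpha_n/\hat\varpi_n,\qquad \widetilde\sigma_n=\hat\sigma_n\Big(\frac{\Upsilon_{\hat\rho_{0,n}}(\hat\varpi_n)}2\Big)^{1/\hat\alpha_n}.$$ Then, as $n\to\infty$, $$(\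widetilde\alpha_n,\widetilde\sigma_n/\sigma_n)\rightsquigarrow(\alpha_0,1).$$
   Context: $\rightsquigarrow$ denotes weak convergence. Fréchet–Welsch distribution: $\mathcal C$ is the set of concave, nonincreasing $\rho:[0,1]\to[0,1]$ with $0\le\rho(\eta)\le1-\eta$ for all $\eta$. For $\rho\in\mathcal C$, $\alpha,\sigma>0$, $\mathcal W(\rho,\alpha,\sigma)$ is the distribution on $(0,\infty)^2$ with cdf $H_{\rho,\alpha,\sigma}(x,y)=\exp(-(x/\sigma)^{-\alpha})$ if $y\ge x>0$ and $\exp(-(y/\sigma)^{-\alpha})\{1+\rho((y/x)^\alpha)(y/\sigma)^{-\alpha}\}$ if $x>y>0$. Maximum likelihood estimator: for $\boldsymbol z=((x_1,y_1),\dots,(x_k,y_k))$, $k\ge2$, $0<y_i\le x_i$, let $\ell(\alpha,\sigma|\boldsymbol z)=2k\log\alpha+2k\alpha\log\sigma-\sum_{i=1}^k\{(\alpha+1)\log(x_iy_i)+\sigma^\alpha y_i^{-\alpha}\}$. If the pairs are not all equal, it has a unique maximizer $\hat\theta(\boldsymbol z)=(\hat\alpha(\boldsymbol z),\hat\sigma(\boldsymbol z))$ over $(0,\infty)^2$. On $\{Z_{n,1}=\cdots=Z_{n,k_n}\}$ set $\hat\alpha_n=\infty$, $\hat\sigma_n=Y_{n,1}$. Constants: for $\rho_0\in[0,1]$, with $\Gamma$ the gamma function and $\gamma$ the Euler–Mascheroni constant, $\Upsilon_{\rho_0}(x)=\rho_0\Gamma(x+2)+(1-\rho_0)\Gamma(x+1)$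 and $\Pi_{\rho_0}(y)=\frac1y-\frac{\Upsilon_{\rho_0}'(y)}{\Upsilon_{\rho_0}(y)}+\frac{\rho_0}2-\gamma$ ($y>0$), which is a continuous decreasing bijection from $(0,\infty)$ to $\mathbb R$; $\varpi_{\rho_0}\in(0,1]$ is its unique zero. Function class: $\mathcal F_1(\alpha_-,\alpha_+)$ consists of $(x,y)\mapsto\log x$, $(x,y)\mapsto\log y$, and $(x,y)\mapsto y^{-\alpha}$, $(x,y)\mapsto y^{-\alpha}\log y$ for all $\alpha_-<\alpha<\alpha_+$. *)

(* Defs.v *)
From HB Require Import structures.
From mathcomp Require Export all_boot all_order all_algebra.
From mathcomp Require Export all_classical all_reals all_analysis.

Set Implicit Arguments.
Unset Strict Implicit.
Unset Printing Implicit Defensive.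

Export Order.TTheory GRing.Theory Num.Theory.
Export numFieldNormedType.Exports.

Local Open Scope classical_set_scope.
Local Open Scope ring_scope.

(* Weak convergence of Borel random elements [X n], each on its own probability
   space, to a deterministic limit [c]: the limit law is the point mass at [c],
   so the limit of the expectations of [f (X n)] is [f c]. *)
Definition weak_cvg_cst (R : realType) (d : nat -> measure_display)
    (Om : forall n, measurableType (d n)) (P : forall n, probability (Om n) R)
    (T : topologicalType) (X : forall n, Om n -> T) (c : T) : Prop :=
  (forall n (U : set T), open U -> measurable (X n @^-1` U)) /\
  (forall f : T -> R, continuous f -> bounded_fun f ->
    'E_(P n)[f \o X n] @[n --> \oo] --> (f c)%:E)%E.

Section Constants.
Variable R : realType.
Implicit Types (rho : R).

Definition Gamma_fun (x : R) : R :=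
  \int[@lebesgue_measure R]_(t in `]0, +oo[) (t `^ (x - 1) * expR (- t)).

Definition euler_mascheroni : R :=
  limn (fun n : nat => series harmonic n - ln n%:R : R).

Definition Upsilon rho (x : R) : R :=
  rho * Gamma_fun (x + 2) + (1 - rho) * Gamma_fun (x + 1).

Definition Pi_fun rho (y : R) : R :=
  y^-1 - derive1 (Upsilon rho) y / Upsilon rho y + rho / 2 - euler_mascheroni.

(* The zero of [Pi_fun rho] in (0, +oo), which is unique for [rho] in [0, 1];
   the default value 1 of [xget] is then never used. *)
Definition varpi rho : R := xget 1 [set y | 0 < y /\ Pi_fun rho y = 0].

End Constants.

Section FrechetWelsch.
Variable R : realType.

(* The class of admissible [rho]; only the values on [0, 1] matter. *)
Definition class_C (rho : R -> R) : Prop :=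
  [/\ convex_function (`[0, 1] : set R) (fun x => - rho x),
      {in `[0, 1] &, nonincreasing_fun rho} &
      {in `[0, 1], forall eta, 0 <= rho eta <= 1 - eta}].

Definition FW_cdf (rho : R -> R) (alpha sigma x y : R) : R :=
  if x <= y then expR (- (x / sigma) `^ (- alpha))
  else expR (- (y / sigma) `^ (- alpha)) *
       (1 + rho ((y / x) `^ alpha) * (y / sigma) `^ (- alpha)).

Definition pos_quadrant : set (R * R) := [set p | 0 < p.1 /\ 0 < p.2].

(* [W] is the distribution on (0, +oo)^2 with cdf [FW_cdf rho alpha sigma]. *)
Definition frechet_welsch (rho : R -> R) (alpha sigma : R)
    (W : probability (R * R)%type R) : Prop :=
  W pos_quadrant = 1%E /\
  forall x y, 0 < x -> 0 < y ->
    W [set p | p.1 <= x /\ p.2 <= y] = (FW_cdf rho alpha sigma x y)%:E.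

Definition class_F1 (am ap : R) : set (R * R -> R) :=
  [set fun p => ln p.1] `|` [set fun p => ln p.2]
  `|` [set (fun p => p.2 `^ (- a)) | a in `]am, ap[]
  `|` [set (fun p => p.2 `^ (- a) * ln p.2) | a in `]am, ap[].

End FrechetWelsch.

Section MaximumLikelihood.
Variable R : realType.
Implicit Types (z : seq (R * R)).

Definition loglik (alpha sigma : R) z : R :=
  2 * (size z)%:R * ln alpha + 2 * (size z)%:R * alpha * ln sigma
  - \sum_(p <- z)
      ((alpha + 1) * ln (p.1 * p.2) + sigma `^ alpha * p.2 `^ (- alpha)).

Definition is_maximizer z (theta : R * R) : Prop :=
  [/\ 0 < theta.1, 0 < theta.2 &
      forall alpha sigma, 0 < alpha -> 0 < sigma ->
        loglik alpha sigma z <= loglik theta.1 theta.2 z].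

(* The maximizer exists and is unique as soon as [z] is not constant and
   [0 < p.2 <= p.1] for all [p] in [z]. *)
Definition theta_hat z : R * R := xget (1, 1) [set theta | is_maximizer z theta].

(* The estimators, extended to samples whose pairs are all equal. *)
Definition alpha_hat z : \bar R :=
  if constant z then +oo%E else (theta_hat z).1%:E.

Definition sigma_hat z : R :=
  if constant z then (head (0, 0) z).2 else (theta_hat z).2.

(* Bias-corrected estimators, [rho] being the estimate of [rho 0]. *)
Definition alpha_tilde rho z : \bar R := (alpha_hat z / (varpi rho)%:E)%E.

(* [(+oo)^-1 = 0], so this is [sigma_hat z] when [alpha_hat z = +oo]. *)
Definition sigma_tilde rho z : R :=
  sigma_hat z * (Upsilon rho (varpi rho) / 2) `^ fine (alpha_hat z)^-1%E.

End MaximumLikelihood.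

Definition sample (R : realType) (Om : Type) (k : nat)
    (Z : 'I_k -> Om -> R * R) (w : Om) : seq (R * R) :=
  [seq Z i w | i <- enum 'I_k].

(* Main.v *)
From HB Require Import structures.
Require Import Defs.
From mathcomp Require Import measurable_realfun ring lra.

Set Implicit Arguments.
Unset Strict Implicit.
Unset Printing Implicit Defensive.

Local Open Scope classical_set_scope.
Local Open Scope ring_scope.

(** Let A(a), B(a) denote the empirical means of y ^ - a and y ^ - a ln y over the
    sample divided by the unknown scale, and L the sum of the empirical means of
    ln x and ln y.  In the coordinates (a, a ln s) the log-likelihood is concave, so
    that its maximizer is the unique critical point ([loglik_lt], [theta_hatP]): the
    shape is the zero of the strictly decreasing score 1 / a + B(a) / A(a) - L / 2,
    and the scale, relative to the unknown one, is (2 / A(a)) ^ (1 / a).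

    The hypotheses give the limits of A(a), B(a), L, as integrals with respect to the
    Frechet-Welsch law.  Under that law Y ^ - alpha0 has density
    (rho0 t + 1 - rho0) e ^ - t on (0, +oo) and X ^ - alpha0 is standard exponential
    ([FW_transfer], [marginal_snd], [marginal_fst]).  The limits are thus expressed by
    the function Upsilon, its derivative, and the Euler-Mascheroni constant, and the
    score at a tends to Pi (a / alpha0) / alpha0 ([score_cvg]), where Pi is taken at
    rho0.  As Pi is decreasing and vanishes at varpi ([varpi_spec]), the sign of the
    score on either side of alpha1 = varpi alpha0 traps the estimated shape near
    alpha1 ([alpha_fin_cvg]).  Convexity in a of A extends the convergence of A to the
    random argument ([emp_powR_alpha_cvg]), and the two bias corrections are then
    continuous functions of convergent quantities.

    Three ingredients are used.  First, the needed part of the theory of the gamma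
    function: its derivative as an integral, and the value - gamma of that derivative
    at 1 ([is_derive_Gamma_fun], [euler_mascheroniE]).  Secondly, a single pointwise
    inequality, [tilt_ge], which integrated or averaged shows that logarithmic
    derivatives of moment functions increase; hence both Pi and the score decrease.
    Thirdly, convergence in probability along the rows of the array is convergence
    along a filter ([prob_filter]), equivalent for measurable maps and a constant
    limit to weak convergence; sums, products and continuous images of convergent sequences are
    then covered by the general theory of filters. *)

(** * Integration of derivatives over the positive half-line *)

Section ImproperFTC.
Variable R : realType.
Notation mu := (@lebesgue_measure R).
Implicit Types f g F : R -> R.

Lemma continuous_gt0_measurable f : (forall x : R, 0 < x -> {for x, continuous f}) ->
  measurable_fun [set` `]0, +oo[ : interval R] f.
Proof.
move=> cf; apply: open_continuous_measurable_fun; first exact: interval_open.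
by move=> x; rewrite inE /= in_itv /= andbT => /cf.
Qed.

(** Compact intervals exhausting the open half-line, on which the fundamental theorem
    of calculus for continuous functions applies. *)
Definition cut_itv (n : nat) : set R := `[n.+2%:R^-1, n.+2%:R].

Lemma nondecreasing_cut_itv : nondecreasing_seq cut_itv.
Proof.
move=> m n mn; apply/subsetPset => x; rewrite /cut_itv /= !in_itv /=.
move=> /andP[mx xm]; apply/andP; split.
  by apply: le_trans mx; rewrite lef_pV2 ?posrE ?ltr0n// ler_nat !ltnS.
by apply: le_trans xm _; rewrite ler_nat !ltnS.
Qed.

Lemma cut_itv_gt0 n x : cut_itv n x -> 0 < x.
Proof.
rewrite /cut_itv /= in_itv /= => /andP[+ _].
by apply: lt_le_trans; rewrite invr_gt0 ltr0n.
Qed.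

Lemma bigcup_cut_itv : \bigcup_n cut_itv n = [set` `]0, +oo[ : interval R].
Proof.
apply/seteqP; split => [x [n _]|x]; rewrite /cut_itv /= !in_itv /= ?andbT.
  by move=> /andP[+ _]; apply: lt_le_trans; rewrite invr_gt0 ltr0n.
move=> x0; exists (Num.truncn (x + x^-1)) => //=; rewrite in_itv /=.
have h : x + x^-1 < (Num.truncn (x + x^-1)).+2%:R.
  by apply: (lt_trans (truncnS_gt _)); rewrite ltr_nat.
have x'0 : 0 < x^-1 by rewrite invr_gt0.
apply/andP; split; last lra.
by rewrite -[leRHS]invrK lef_pV2 ?posrE ?ltr0n//; lra.
Qed.

Lemma cut_itv_cvg f : (forall x : R, 0 < x -> {for x, continuous f}) ->
    (forall x, 0 < x -> 0 <= f x) ->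
  (\int[mu]_(x in cut_itv n) (f x)%:E)%E @[n --> \oo] -->
    (\int[mu]_(x in `]0%R, +oo[) (f x)%:E)%E.
Proof.
move=> cf f0; rewrite -bigcup_cut_itv.
apply: ge0_nondecreasing_set_cvg_integral.
- exact: nondecreasing_cut_itv.
- by move=> n; exact: measurable_itv.
- move=> n; apply/measurable_EFinP.
  apply: (measurable_funS (E := [set` `]0, +oo[ : interval R])) => //=.
    by move=> x /cut_itv_gt0; rewrite /= in_itv /= andbT.
  exact: continuous_gt0_measurable.
- by move=> n x /cut_itv_gt0 /f0; rewrite lee_fin.
Qed.

Lemma cut_itv_FTC n f F : (forall x : R, 0 < x -> {for x, continuous f}) ->
    (forall x : R, 0 < x -> is_derive x 1 F (f x)) ->
  (\int[mu]_(x in cut_itv n) (f x)%:E = (F n.+2%:R)%:E - (F n.+2%:R^-1)%:E)%E.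
Proof.
move=> cf dF.
have n0 : 0 < n.+2%:R :> R by rewrite ltr0n.
have ltn : n.+2%:R^-1 < n.+2%:R :> R.
  rewrite (@lt_trans _ _ 1)//; last by rewrite ltr1n.
  by rewrite invf_lt1 ?ltr1n.
have V0 : 0 < n.+2%:R^-1 :> R by rewrite invr_gt0.
have cF x : 0 < x -> {for x, continuous F}.
  move=> x0; apply/differentiable_continuous/derivable1_diffP.
  by have [] := dF x x0.
rewrite /cut_itv (@continuous_FTC2 _ f F)//.
- apply/(continuous_within_itvP _ ltn); split.
  + by move=> x /[!in_itv]/= /andP[ax _]; apply: cf; exact: lt_trans ax.
  + by apply: cvg_at_right_filter; exact: cf.
  + by apply: cvg_at_left_filter; exact: cf.
- split.
  + move=> x /[!in_itv]/= /andP[ax _].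
    by have [] := dF x (lt_trans V0 ax).
  + by apply: cvg_at_right_filter; exact: cF.
  + by apply: cvg_at_left_filter; exact: cF.
- move=> x /[!in_itv]/= /andP[ax _].
  by rewrite derive1E; have [_ ->] := dF x (lt_trans V0 ax).
Qed.

(** A bounded primitive bounds the integrals over all compact subintervals, hence the
    integral over the half-line. *)
Lemma integral_0y_le f F C : (forall x : R, 0 < x -> {for x, continuous f}) ->
    (forall x, 0 < x -> 0 <= f x) ->
    (forall x : R, 0 < x -> is_derive x 1 F (f x)) ->
    (forall x, 0 < x -> 0 <= F x <= C) ->
  (\int[mu]_(x in `]0%R, +oo[) (f x)%:E <= C%:E)%E.
Proof.
move=> cf f0 dF bF; have := cut_itv_cvg cf f0.
move/cvge_to_le; apply; apply: nearW => n.
rewrite (cut_itv_FTC n cf dF) -EFinD lee_fin.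
have n0 : 0 < n.+2%:R :> R by rewrite ltr0n.
have V0 : 0 < n.+2%:R^-1 :> R by rewrite invr_gt0.
have := bF _ n0; have := bF _ V0; lra.
Qed.

(** The derivative is split as f - g with f and g nonnegative, since monotone
    convergence along the exhaustion applies to each of them separately; this gives
    both the finiteness of the integral of f and its value. *)
Lemma integral_0y_FTC f g F (l0 l1 : R) :
    (forall x : R, 0 < x -> {for x, continuous f}) -> (forall x : R, 0 < x -> {for x, continuous g}) ->
    (forall x, 0 < x -> 0 <= f x) -> (forall x, 0 < x -> 0 <= g x) ->
    (forall x : R, 0 < x -> is_derive x 1 F (f x - g x)) ->
    F x @[x --> 0^'+] --> l0 -> F x @[x --> +oo] --> l1 ->
    (\int[mu]_(x in `]0%R, +oo[) (g x)%:E < +oo)%E ->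
  (\int[mu]_(x in `]0%R, +oo[) (f x)%:E =
   (l1 - l0)%:E + \int[mu]_(x in `]0%R, +oo[) (g x)%:E)%E.
Proof.
move=> cf cg f0 g0 dF Fl0 Fl1 goo.
have Fn1 : F n.+2%:R @[n --> \oo] --> l1.
  move/cvg_pinftyP : Fl1; apply; apply/cvgryPge => A; near=> n.
  rewrite (@le_trans _ _ n%:R)//; last by rewrite ler_nat ltnW.
  by near: n; exact: nbhs_infty_ger.
have Fn0 : F n.+2%:R^-1 @[n --> \oo] --> l0.
  move/cvg_at_rightP : Fl0; apply; split => [n|]; first by rewrite invr_gt0 ltr0n.
  have := @cvg_harmonic R; rewrite -(cvg_shiftn 1)/=.
  by under eq_fun do rewrite addn1.
have int n (h : R -> R) : (forall x : R, 0 < x -> {for x, continuous h}) ->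
    mu.-integrable (cut_itv n) (EFin \o h).
  move=> ch; apply: continuous_compact_integrable; first exact: segment_compact.
  apply: continuous_in_subspaceT => x /[!inE] /cut_itv_gt0; exact: ch.
have H n : (\int[mu]_(x in cut_itv n) (f x)%:E = (F n.+2%:R - F n.+2%:R^-1)%:E +
   \int[mu]_(x in cut_itv n) (g x)%:E)%E.
  rewrite EFinB -(cut_itv_FTC n _ dF); last first.
    by move=> x x0; apply: cvgB; [exact: cf|exact: cg].
  rewrite integralB_EFin//; [|exact: measurable_itv|exact: int..].
  rewrite subeK//; apply: integrable_fin_num; first exact: measurable_itv.
  exact: int.
have cvf := cut_itv_cvg cf f0; have cvg' := cut_itv_cvg cg g0.
apply: (cvg_unique _ cvf) => //.
rewrite (funext H); apply: cvgeD => //.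
by apply: cvg_EFin; [exact: nearW|exact: cvgB].
Unshelve. all: by end_near. Qed.
End ImproperFTC.

(** * Elementary inequalities for powers and exponentials *)

Section Elementary.
Variable R : realType.
Implicit Types a b c d h l m t u x y : R.

Lemma powR_gt0E a x : 0 < a -> a `^ x = expR (x * ln a).
Proof. by move=> a0; rewrite /powR gt_eqF. Qed.

Lemma powRD_gt0 a x y : 0 < a -> a `^ (x + y) = a `^ x * a `^ y.
Proof. by move=> a0; rewrite powRD// (gt_eqF a0) implybT. Qed.

Lemma continuous_powR_gt0 x a : 0 < a -> {for a, continuous (@powR R ^~ x)}.
Proof.
move=> a0; apply/differentiable_continuous/derivable1_diffP.
by have [] := is_derive1_powR x a0.
Qed.

Lemma continuous_expRN : continuous (fun t => expR (- t)).
Proof. by move=> t; apply: continuous_comp; [exact: opp_continuous|exact: continuous_expR]. Qed.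

(** ln (u / c) < u / c, multiplied by c and exponentiated. *)
Lemma powR_le_expR c u : 0 < c -> 0 < u -> u `^ c <= c `^ c * expR u.
Proof.
move=> c0 u0; rewrite !powR_gt0E// -expRD ler_expR -lerBlDl -mulrBr -ln_div//.
have := ltW (ln_sublinear (divr_gt0 u0 c0)).
by rewrite -(ler_pM2l c0) [X in _ <= X]mulrC divfK ?gt_eqF.
Qed.

Lemma expR_normr_le u : expR `|u| <= expR u + expR (- u).
Proof.
have [u0|u0] := leP 0 u; first by rewrite ger0_norm// lerDl expR_ge0.
by rewrite ltr0_norm// lerDr expR_ge0.
Qed.

(** A first-order Taylor estimate for the exponential; both bounds are obtained from
    1 + u <= exp u at u and at - u. *)
Lemma expR_sub1_bound u : `|expR u - 1 - u| <= u ^+ 2 * expR `|u|.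
Proof.
have lo := expR_ge1Dx u.
rewrite ger0_norm; last lra.
have := expR_ge1Dx (- u); rewrite expRN => hi.
have e0 := expR_gt0 u.
have {}hi : expR u - 1 <= u * expR u.
  move: hi; rewrite -(ler_pM2r e0) mulVf ?gt_eqF// => hi; nra.
have [u0|u0] := leP 0 u.
  by rewrite ger0_norm// expr2 -mulrA; have := ler_wpM2l u0 hi; lra.
rewrite ltr0_norm//.
have u1 : 0 <= - u by lra.
have e1 : 1 <= expR (- u) by rewrite -expR0 ler_expR.
have := ler_wpM2l u1 lo; have := ler_wpM2l (sqr_ge0 u) e1.
rewrite mulr1 expr2; lra.
Qed.

Lemma normr_ln_le d t : 0 < d -> 0 < t -> `|ln t| <= d^-1 * (t `^ d + t `^ (- d)).
Proof.
move=> d0 t0; rewrite ler_pdivlMl// !powR_gt0E// mulNr.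
apply: le_trans (expR_normr_le _); rewrite normrM gtr0_norm//.
by apply: le_trans (expR_ge1Dx _); rewrite lerDr.
Qed.

Lemma expR_sub1_le u : `|expR u - 1| <= `|u| * expR `|u|.
Proof.
have e0 := expR_gt0 u; have lo := expR_ge1Dx u.
have [u0|u0] := leP 0 u.
  have e1 : 1 <= expR u by rewrite -expR0 ler_expR.
  rewrite !ger0_norm ?subr_ge0//.
  have := expR_ge1Dx (- u); rewrite expRN -(ler_pM2r e0) mulVf ?gt_eqF//.
  by rewrite mulrDl mul1r mulNr; lra.
have e1 : expR u <= 1 by rewrite -expR0 ler_expR ltW.
rewrite ler0_norm ?subr_le0// ltr0_norm//.
have u1 : 0 <= - u by lra.
have e2 : 1 <= expR (- u) by rewrite -expR0 ler_expR.
have := ler_wpM2l u1 e2; lra.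
Qed.

Lemma sqr_ln_expR_le d t : 0 < d -> 0 < t ->
  `|ln t| ^+ 2 * expR (d * `|ln t|) <= d^-1 ^+ 2 * (t `^ (3 * d) + t `^ (- (3 * d))).
Proof.
move=> d0 t0; set l := ln t.
rewrite exprVn ler_pdivlMl ?exprn_gt0//.
rewrite !powR_gt0E// mulNr -/l; apply: le_trans (expR_normr_le _).
have -> : `|3 * d * l| = d * `|l| + d * `|l| + d * `|l|.
  by rewrite !normrM (gtr0_norm d0) gtr0_norm//; ring.
rewrite !expRD mulrA -exprMn.
have dl0 : 0 <= d * `|l| by rewrite mulr_ge0 // ltW.
rewrite ler_wpM2r ?expR_ge0// expr2 ler_pM//; apply: le_trans (expR_ge1Dx _); rewrite lerDr//.
Qed.

(** Taylor's formula for the power function in its exponent.  The bound is again a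
    combination of powers of t, so that it can be integrated against any weight
    having moments, and derivatives pass under integrals without a limit theorem. *)
Lemma powR_taylor1 d h y t : 0 < d -> `|h| <= d -> 0 < t ->
  `|t `^ (y + h) - t `^ y - h * (t `^ y * ln t)| <=
  h ^+ 2 * (d^-1 ^+ 2 * (t `^ (y + 3 * d) + t `^ (y - 3 * d))).
Proof.
move=> d0 hd t0; set l := ln t.
have -> : t `^ (y + h) - t `^ y - h * (t `^ y * ln t) =
    t `^ y * (expR (h * l) - 1 - h * l).
  by rewrite powRD_gt0// [t `^ h]powR_gt0E// /l; ring.
rewrite normrM ger0_norm ?powR_ge0// !powRD_gt0// -mulrDr.
rewrite [leRHS](_ : _ = t `^ y * (h ^+ 2 * (d^-1 ^+ 2 * (t `^ (3 * d) + t `^ (- (3 * d)))))); last ring.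
rewrite ler_wpM2l ?powR_ge0//; apply: le_trans (expR_sub1_bound _) _.
rewrite exprMn -mulrA ler_wpM2l ?sqr_ge0// -(real_normK (num_real l)).
apply: le_trans (sqr_ln_expR_le d0 t0); rewrite -/l.
by rewrite ler_wpM2l ?sqr_ge0// ler_expR normrM ler_wpM2r.
Qed.

(** The same control for the derivative of the power in its exponent. *)
Lemma powR_ln_lipschitz d h y t : 0 < d -> `|h| <= d -> 0 < t ->
  `|t `^ (y + h) * ln t - t `^ y * ln t| <=
  `|h| * (d^-1 ^+ 2 * (t `^ (y + 3 * d) + t `^ (y - 3 * d))).
Proof.
move=> d0 hd t0; set l := ln t.
rewrite -mulrBl powRD_gt0// -{2}[t `^ y]mulr1 -mulrBr [t `^ h]powR_gt0E// -/l.
rewrite !normrM (ger0_norm (powR_ge0 _ _)) !powRD_gt0// -mulrDr.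
rewrite [leRHS](_ : _ = t `^ y * (`|h| * (d^-1 ^+ 2 * (t `^ (3 * d) + t `^ (- (3 * d)))))); last ring.
rewrite -mulrA ler_wpM2l ?powR_ge0//.
apply: (@le_trans _ _ (`|h| * (`|l| ^+ 2 * expR (d * `|l|)))).
  apply: (@le_trans _ _ (`|h * l| * expR `|h * l| * `|l|)).
    by rewrite ler_wpM2r// expR_sub1_le.
  rewrite !normrM [leLHS](_ : _ = `|h| * (`|l| ^+ 2 * expR (`|h| * `|l|))); last ring.
  by rewrite !ler_wpM2l ?sqr_ge0// ler_expR ler_wpM2r.
rewrite ler_wpM2l//; exact: sqr_ln_expR_le.
Qed.


(** Both l - m and exp ((b - a) l) - exp ((b - a) m) have the sign of l - m, so their
    product is nonnegative; multiplying by exp (a l) gives the claim.  When m is the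
    logarithmic derivative at a of the mean of exp (a l), the mean of the left-hand
    side vanishes, and the inequality says that the logarithmic derivative at b is at
    least m. *)
Lemma tilt_ge m l a b : a <= b ->
  expR ((b - a) * m) * ((l - m) * expR (a * l)) <= (l - m) * expR (b * l).
Proof.
move=> ab; rewrite (_ : b * l = (b - a) * l + a * l); last by ring.
rewrite expRD mulrCA [leRHS]mulrCA -subr_ge0 [X in 0 <= X](_ : _ =
  expR (a * l) * ((l - m) * (expR ((b - a) * l) - expR ((b - a) * m)))); last first.
  by ring.
rewrite mulr_ge0 ?expR_ge0//.
have [lm|lm] := leP m l.
  by rewrite mulr_ge0 ?subr_ge0// ler_expR ler_wpM2l// subr_ge0.
rewrite mulr_le0 ?subr_le0 ?(ltW lm)// ler_expR ler_wpM2l// ?subr_ge0// ltW//.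
Qed.

Lemma quadratic_is_derive (f : R -> R) x dfx C d : 0 < d ->
  (forall h, `|h| <= d -> `|f (x + h) - f x - h * dfx| <= h ^+ 2 * C) ->
  is_derive x 1 f dfx.
Proof.
move=> d0 fh; have C0 : 0 <= C.
  have := fh d; rewrite ger0_norm ?(ltW d0)// => /(_ (lexx _)) H.
  by have := le_trans (normr_ge0 _) H; rewrite pmulr_rge0// exprn_gt0.
suff H : (fun h => h^-1 *: ((f \o shift x) (h *: 1) - f x)) @ 0^' --> dfx.
  by apply: DeriveDef; [apply/cvg_ex; exists dfx|exact: cvg_lim H].
apply/cvgrPdist_le => e e0; near=> h.
have h0 : h != 0 by near: h; exact: nbhs_dnbhs_neq.
have hd : `|h| <= d.
  by near: h; apply: dnbhs0_le.
have he : `|h| <= e / (C + 1).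
  by near: h; apply: dnbhs0_le; rewrite divr_gt0//; lra.
rewrite /= [h *: _]mulr1 [h + x]addrC.
have -> : dfx - h^-1 *: (f (x + h) - f x) = - (h^-1 * (f (x + h) - f x - h * dfx)).
  by rewrite /GRing.scale /=; field.
rewrite normrN normrM normfV ler_pdivrMl ?normr_gt0//.
apply: le_trans (fh _ hd) _; rewrite -(real_normK (num_real h)) expr2 -mulrA.
rewrite ler_wpM2l//; move: he; rewrite ler_pdivlMr ?ltr_wpDl// => he.
by apply: le_trans he; rewrite mulrDr mulr1 lerDl.
Unshelve. all: by end_near. Qed.

End Elementary.

(** * The gamma function and its derivative *)

Section RealIntegrable.
Context d (T : measurableType d) (R : realType).
Variables (mu : {measure set T -> \bar R}) (D : set T).
Hypothesis mD : measurable D.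
Implicit Types f g : T -> R.

Lemma integrable_EFinZ k f : mu.-integrable D (EFin \o f) ->
  mu.-integrable D (EFin \o (fun t => k * f t)).
Proof. by move=> fi; exact: (integrableZl mD k fi). Qed.

Lemma integrable_EFinD f g : mu.-integrable D (EFin \o f) ->
  mu.-integrable D (EFin \o g) -> mu.-integrable D (EFin \o (fun t => f t + g t)).
Proof. by move=> fi gi; exact: (integrableD mD fi gi). Qed.

Lemma integrable_EFinB f g : mu.-integrable D (EFin \o f) ->
  mu.-integrable D (EFin \o g) -> mu.-integrable D (EFin \o (fun t => f t - g t)).
Proof. by move=> fi gi; exact: (integrableB mD fi gi). Qed.

Lemma le_integrable_EFin f g : measurable_fun D f ->
  (forall t, D t -> `|f t| <= g t) -> mu.-integrable D (EFin \o g) ->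
  mu.-integrable D (EFin \o f).
Proof.
move=> mf fg; apply: le_integrable => //; first exact/measurable_EFinP.
by move=> t Dt /=; rewrite lee_fin (le_trans (fg t Dt))// ler_norm.
Qed.

Lemma eq_integrable_EFin f g : (forall t, D t -> f t = g t) ->
  mu.-integrable D (EFin \o f) -> mu.-integrable D (EFin \o g).
Proof. by move=> fg; apply: eq_integrable => // t /[!inE] /fg /= ->. Qed.

End RealIntegrable.

Section GammaFunction.
Variable R : realType.
Notation mu := (@lebesgue_measure R).
Notation D0 := [set` `]0, +oo[ : interval R].
Implicit Types x y t : R.

Let m0 : measurable (D0 : set (measurableTypeR R)).
Proof. exact: measurable_itv. Qed.

Lemma in_D0 t : D0 t -> 0 < t.
Proof. by rewrite /= in_itv /= andbT. Qed.

Lemma is_derive1_comp_eq (f g : R -> R) x a b c :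
  is_derive (g x) 1 f a -> is_derive x 1 g b -> a * b = c ->
  is_derive x 1 (fun t => f (g t)) c.
Proof. by move=> df dg <-; exact: (is_derive1_comp df dg). Qed.

Lemma is_derive1D_eq (f g : R -> R) x a b c :
  is_derive x 1 f a -> is_derive x 1 g b -> a + b = c ->
  is_derive x 1 (fun t => f t + g t) c.
Proof. by move=> df dg <-; exact: (is_deriveD df dg). Qed.

Lemma is_derive1M_eq (f g : R -> R) x a b c :
  is_derive x 1 f a -> is_derive x 1 g b -> f x * b + g x * a = c ->
  is_derive x 1 (fun t => f t * g t) c.
Proof. by move=> df dg <-; exact: (is_deriveM df dg). Qed.

Lemma is_derive1_continuous (f : R -> R) x a :
  is_derive x 1 f a -> {for x, continuous f}.
Proof.
by move=> [df _]; exact/differentiable_continuous/derivable1_diffP.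
Qed.

Lemma is_derive1_expRN t : is_derive t 1 (fun t => expR (- t)) (- expR (- t)).
Proof.
have dN : is_derive t 1 (fun t : R => - t) (- 1) by exact: is_deriveN.
by refine (is_derive1_comp_eq (is_derive_expR _) dN _); rewrite mulrN1.
Qed.

Lemma continuous_powR_expRN y t : 0 < t ->
  {for t, continuous (fun t => t `^ y * expR (- t))}.
Proof.
by move=> t0; apply: cvgM; [exact: continuous_powR_gt0|exact: continuous_expRN].
Qed.

(** The bounded function (t / (1 + t)) ^ x has a derivative comparable to t ^ (x - 1) at
    0 and decaying polynomially at infinity: it dominates the integrand of the gamma
    function up to a constant factor. *)
Lemma integrable_powR_expRN y : -1 < y ->
  mu.-integrable D0 (EFin \o (fun t => t `^ y * expR (- t))).
Proof.
move=> y1; pose x := y + 1; have x0 : 0 < x by rewrite /x; lra.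
pose f t := x * (t / (1 + t)) `^ y * (1 + t) ^- 2.
pose F t := (t / (1 + t)) `^ x.
have q0 t : 0 < t -> 0 < t / (1 + t) by move=> t0; rewrite divr_gt0//; lra.
have dq t : 0 < t -> is_derive t 1 (fun t => t / (1 + t)) ((1 + t) ^- 2).
  move=> t0; have t1 : 1 + t != 0 by rewrite gt_eqF//; lra.
  have d1 : is_derive t 1 (fun t => 1 + t : R) 1.
    by apply: is_derive1D_eq; rewrite add0r.
  have dv := is_deriveV t1 d1.
  refine (is_derive1M_eq (is_derive_id t 1) dv _).
  by rewrite /GRing.scale /=; field.
have dF t : 0 < t -> is_derive t 1 F (f t).
  move=> t0; refine (@is_derive1_comp_eq (@powR R ^~ x) (fun t => t / (1 + t)) _ _ _ _ (is_derive1_powR x (q0 t t0)) (dq t t0) _).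
  by rewrite /f /x addrK.
have cf t : 0 < t -> {for t, continuous f}.
  move=> t0; apply: cvgM.
    apply: cvgM; first exact: cvg_cst.
    apply: (@continuous_comp _ _ _ (fun t => t / (1 + t)) (@powR R ^~ y)).
      exact: is_derive1_continuous (dq t t0).
    exact/continuous_powR_gt0/q0.
  apply: cvgV; first by rewrite gt_eqF// exprn_gt0//; lra.
  by apply: cvgM; apply: cvgD; [exact: cvg_cst|exact: cvg_id|exact: cvg_cst|exact: cvg_id].
have f0 t : 0 < t -> 0 <= f t.
  move=> t0; rewrite /f !mulr_ge0 ?powR_ge0 ?(ltW x0)// invr_ge0 exprn_ge0//; lra.
have bF t : 0 < t -> 0 <= F t <= 1.
  move=> t0; rewrite /F powR_ge0/=.
  rewrite -[leRHS](_ : 1 `^ x = 1); last by rewrite powR1.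
  apply: ge0_ler_powR; first exact: ltW.
  - rewrite nnegrE; apply: ltW; exact: q0.
  - by rewrite nnegrE.
  - by rewrite ler_pdivrMr ?mul1r; lra.
have If := integral_0y_le cf f0 dF bF.
have intf : mu.-integrable D0 (EFin \o f).
  apply/integrableP; split.
    by apply/measurable_EFinP; exact: continuous_gt0_measurable.
  apply: le_lt_trans (ltry 1); apply: le_trans If; rewrite le_eqVlt; apply/orP; left.
  apply/eqP/eq_integral => t /[!inE] /in_D0 t0.
  by rewrite /= ger0_norm// f0.
(* the constant of (1 + t) ^ (x + 1) <= K x e ^ t *)
pose K := (x + 1) `^ (x + 1) * expR 1 / x.
refine (@le_integrable_EFin _ _ R mu D0 _ _ (fun t => K * f t) _ _ _).
- exact: measurable_itv.
- apply: continuous_gt0_measurable => t; exact: continuous_powR_expRN.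
- move=> t /in_D0 t0; rewrite ger0_norm; last by rewrite mulr_ge0 ?powR_ge0 ?expR_ge0.
  have t1 : 0 < 1 + t by lra.
  have x1 : 0 < x + 1 by lra.
  have := powR_le_expR x1 t1; rewrite expRD => H.
  have -> : K * f t = t `^ y * ((x + 1) `^ (x + 1) * expR 1) / (1 + t) `^ (x + 1).
    have -> : (1 + t) `^ (x + 1) = (1 + t) `^ y * (1 + t) ^+ 2.
      rewrite -powR_mulrn ?(ltW t1)// -powRD_gt0//; congr (_ `^ _).
      by rewrite /x; ring.
    rewrite /K /f powRM ?(ltW t0) ?invr_ge0 ?(ltW t1)//.
    rewrite -(@powR_inv1 _ (1 + t)) ?(ltW t1)// -powRrM mulN1r powRN.
    by field; rewrite !gt_eqF ?powR_gt0.
  rewrite -mulrA ler_wpM2l ?powR_ge0// ler_pdivlMr ?powR_gt0// expRN.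
  by rewrite mulrC ler_pdivrMr ?expR_gt0// -mulrA.
- by apply: integrable_EFinZ => //; exact: measurable_itv.
Qed.

Lemma cvg_powR_expRN_0 y : 0 < y -> t `^ y * expR (- t) @[t --> 0^'+] --> (0 : R).
Proof.
move=> y0; rewrite -[X in _ --> X](mul0r (expR (- 0) : R)); apply: cvgM; first exact: powR_cvg0.
by apply: cvg_at_right_filter; exact: continuous_expRN.
Qed.

Lemma cvg_powR_expRN_y y : 0 < y -> t `^ y * expR (- t) @[t --> +oo] --> (0 : R).
Proof.
move=> y0; pose C := (y + 1) `^ (y + 1) : R.
apply: (@squeeze_cvgr _ _ _ _ (fun=> 0) (fun t => C * t^-1)).
- near=> t; have t0 : 0 < t by near: t; exact: nbhs_pinfty_gt.
  have y1 : 0 < y + 1 by lra.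
  have := powR_le_expR y1 t0; rewrite powRD_gt0// powRr1 ?(ltW t0)// => H.
  rewrite mulr_ge0 ?powR_ge0 ?expR_ge0//= ler_pdivlMr// expRN mulrAC.
  by rewrite ler_pdivrMr ?expR_gt0.
- exact: cvg_cst.
- rewrite -[X in _ --> X](mulr0 C); apply: cvgM; first exact: cvg_cst.
  apply/gtr0_cvgV0; last exact: cvg_id.
  by near=> t; near: t; exact: nbhs_pinfty_gt.
Unshelve. all: by end_near. Qed.

Lemma Gamma_funD1 x : 0 < x -> Gamma_fun (x + 1) = x * Gamma_fun x.
Proof.
move=> x0; have x1 : -1 < x - 1 by lra.
have x1' : -1 < x by lra.
pose g t := x * (t `^ (x - 1) * expR (- t)).
pose F t := - (t `^ x * expR (- t)).
have intg : mu.-integrable D0 (EFin \o g) by apply: integrable_EFinZ => //; exact: integrable_powR_expRN.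
have := @integral_0y_FTC R (fun t => t `^ x * expR (- t)) g F 0 0.
rewrite subrr add0e => H; rewrite /Gamma_fun addrK -RintegralZl//; first last.
- exact: integrable_powR_expRN.
congr fine; apply: H.
- by move=> t; exact: continuous_powR_expRN.
- move=> t t0; apply: cvgM; [exact: cvg_cst|exact: continuous_powR_expRN].
- by move=> t t0; rewrite mulr_ge0 ?powR_ge0 ?expR_ge0.
- by move=> t t0; rewrite !mulr_ge0 ?powR_ge0 ?expR_ge0 ?ltW.
- move=> t t0.
  have dP : is_derive t 1 (fun t => t `^ x * expR (- t))
      (g t - t `^ x * expR (- t)).
    refine (is_derive1M_eq (is_derive1_powR x t0) (is_derive1_expRN t) _).
    by rewrite /g /=; ring.
  by rewrite -opprB; apply: is_deriveN.
- by rewrite -[X in _ --> X]oppr0; apply: cvgN; exact: cvg_powR_expRN_0.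
- by rewrite -[X in _ --> X]oppr0; apply: cvgN; exact: cvg_powR_expRN_y.
- by apply: integrable_lty intg; exact: measurable_itv.
Qed.

Lemma Gamma_fun1 : Gamma_fun 1 = 1 :> R.
Proof.
have := @integral_0y_FTC R (fun t => expR (- t)) (fun=> 0) (fun t => - expR (- t)) (- 1) 0.
rewrite sub0r opprK integral0 adde0 => H; rewrite /Gamma_fun.
under eq_Rintegral do rewrite subrr powRr0 mul1r.
rewrite -[RHS]/(fine 1%:E); congr fine; apply: H.
- by move=> t _; exact: continuous_expRN.
- by move=> t _; exact: cvg_cst.
- by move=> t _; exact: expR_ge0.
- by [].
- by move=> t t0; rewrite subr0 -[expR (- t)]opprK; apply: is_deriveN; exact: is_derive1_expRN.
- apply: cvgN; have -> : (1 : R) = expR (- 0) by rewrite oppr0 expR0.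
  by apply: cvg_at_right_filter; exact: continuous_expRN.
- by rewrite -[X in _ --> X]oppr0; apply: cvgN; exact: cvgr_expR.
- exact: ltry.
Qed.

Lemma Gamma_fun_nat n : Gamma_fun n.+1%:R = n`!%:R :> R.
Proof.
elim: n => [|n IH]; first exact: Gamma_fun1.
by rewrite -natr1 Gamma_funD1 ?ltr0n// IH -natrM -factS.
Qed.

(** The derivative of the gamma function, as an integral. *)
Definition Gamma_ln x : R :=
  \int[mu]_(t in `]0, +oo[) (t `^ (x - 1) * ln t * expR (- t)).

Lemma continuous_powR_ln_expRN y t : 0 < t ->
  {for t, continuous (fun t => t `^ y * ln t * expR (- t))}.
Proof.
move=> t0; apply: cvgM; last exact: continuous_expRN.
by apply: cvgM; [exact: continuous_powR_gt0|exact: continuous_ln].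
Qed.

(** |ln t| is at most a multiple of t ^ d + t ^ (- d), which only shifts the exponent by
    an amount d leaving it in the domain of integrability. *)
Lemma integrable_powR_ln_expRN y : -1 < y ->
  mu.-integrable D0 (EFin \o (fun t => t `^ y * ln t * expR (- t))).
Proof.
move=> y1; pose d := (y + 1) / 2; have d0 : 0 < d by rewrite /d; lra.
have I1 : -1 < y + d by lra.
have I2 : -1 < y - d by rewrite /d; lra.
have I := integrable_EFinD m0
  (integrable_powR_expRN I1) (integrable_powR_expRN I2).
have {}I := integrable_EFinZ m0 d^-1 I.
apply: (le_integrable_EFin _ _ _ I); first exact: measurable_itv.
  by apply: continuous_gt0_measurable => t; exact: continuous_powR_ln_expRN.
move=> t /in_D0 t0; rewrite !normrM (ger0_norm (powR_ge0 _ _)) (ger0_norm (expR_ge0 _)).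
rewrite [leRHS](_ : _ = t `^ y * (d^-1 * (t `^ d + t `^ (- d))) * expR (- t)).
  by rewrite ler_wpM2r ?expR_ge0// ler_wpM2l ?powR_ge0// normr_ln_le.
by rewrite !powRD_gt0//; ring.
Qed.

Lemma is_derive_Gamma_fun x : 0 < x -> is_derive x 1 (@Gamma_fun R) (Gamma_ln x).
Proof.
move=> x0; pose d := x / 6; have d0 : 0 < d by rewrite /d; lra.
pose C := d^-1 ^+ 2 * (Gamma_fun (x + 3 * d) + Gamma_fun (x - 3 * d)).
apply: (@quadratic_is_derive _ _ _ _ C d) => // h hd.
have [hd1 hd2] := ler_normlP _ _ hd.
have I1 : -1 < x - 1 by lra.
have I2 : -1 < x + h - 1 by move: hd1; rewrite /d; lra.
have I3 : -1 < x + 3 * d - 1 by lra.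
have I4 : -1 < x - 3 * d - 1 by rewrite /d; lra.
have i1 := integrable_powR_expRN I1; have i2 := integrable_powR_expRN I2.
have i3 := integrable_powR_expRN I3; have i4 := integrable_powR_expRN I4.
have il := integrable_powR_ln_expRN I1.
have i34 := integrable_EFinD m0 i3 i4.
have i12 := integrable_EFinB m0 i2 i1.
have il' := integrable_EFinZ m0 h il.
rewrite /C /Gamma_fun /Gamma_ln -RintegralD// -!RintegralZl//; last first.
  exact: integrable_EFinZ.
rewrite -!RintegralB//.
apply: le_trans (le_normr_Rintegral _ _) _ => //; first exact: integrable_EFinB.
apply: le_Rintegral => //.
- by apply: integrable_norm; exact: integrable_EFinB.
- by do 2 apply: integrable_EFinZ => //.
- move=> t /in_D0 t0; have := powR_taylor1 (x - 1) d0 hd t0.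
  have E := expR_ge0 (- t).
  move=> /(ler_wpM2r E).
  rewrite -[X in _ * X <= _ -> _]ger0_norm// -normrM.
  have -> : x - 1 + h = x + h - 1 by ring.
  have -> : x - 1 + 3 * d = x + 3 * d - 1 by ring.
  have -> : x - 1 - 3 * d = x - 3 * d - 1 by ring.
  move=> H; rewrite [leLHS](_ : _ = `|(t `^ (x + h - 1) - t `^ (x - 1) -
      h * (t `^ (x - 1) * ln t)) * expR (- t)|); last by congr `|_|; ring.
  apply: le_trans H _; rewrite le_eqVlt; apply/orP; left; apply/eqP; ring.
Qed.

End GammaFunction.

(** * The digamma function at the integers and the Euler-Mascheroni constant *)

Section GammaLog.
Variable R : realType.
Notation mu := (@lebesgue_measure R).
Notation D0 := [set` `]0, +oo[ : interval R].
Implicit Types x y t rho : R.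

Let m0 : measurable (D0 : set (measurableTypeR R)).
Proof. exact: measurable_itv. Qed.

(** Jensen's inequality for the exponential law: t ^ y lies above its tangent, as a
    function of ln t, at the mean of ln t, and the integral of that tangent is
    positive. *)
Lemma Gamma_fun_gt0 x : 0 < x -> 0 < Gamma_fun x.
Proof.
move=> x0; pose y := x - 1.
have [m mE] : exists m : R, m = Gamma_ln 1 by exists (Gamma_ln 1).
suff : expR (y * m) <= Gamma_fun x by apply: lt_le_trans; exact: expR_gt0.
have i0 : -1 < 1 - 1 :> R by lra.
have iy : -1 < x - 1 by lra.
have j1 := integrable_powR_expRN i0; have j2 := integrable_powR_ln_expRN i0.
have -> : expR (y * m) = expR (y * m) * (1 - y * m) * Gamma_fun 1 +
    expR (y * m) * y * Gamma_ln 1.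
  by rewrite Gamma_fun1 -mE; ring.
rewrite /Gamma_fun /Gamma_ln -!RintegralZl// -RintegralD//; try exact: integrable_EFinZ.
apply: le_Rintegral => //.
- by apply: integrable_EFinD => //; apply: integrable_EFinZ.
- exact: integrable_powR_expRN.
- move=> t /in_D0 t0; rewrite subrr powRr0 !mul1r mulrA -mulrDl.
  rewrite ler_wpM2r ?expR_ge0// -/y powR_gt0E//.
  have -> : y * ln t = y * m + y * (ln t - m) by ring.
  rewrite expRD [leLHS](_ : _ = expR (y * m) * (1 + y * (ln t - m))); last ring.
  by rewrite ler_wpM2l ?expR_ge0// expR_ge1Dx.
Qed.

(** Differentiation of the functional equation. *)
Lemma Gamma_lnD1 x : 0 < x -> Gamma_ln (x + 1) = x * Gamma_ln x + Gamma_fun x.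
Proof.
move=> x0.
have d1 : is_derive x 1 (fun y => Gamma_fun (y + 1)) (Gamma_ln (x + 1)).
  have ds : is_derive x 1 (fun y => y + 1 : R) 1.
    by apply: is_derive1D_eq; rewrite addr0.
  have x1 : 0 < x + 1 by lra.
  refine (@is_derive1_comp_eq _ (@Gamma_fun R) (fun y => y + 1) _ _ _ _ (is_derive_Gamma_fun x1) ds _).
  by rewrite mulr1.
have d2 : is_derive x 1 (fun y => y * Gamma_fun y) (x * Gamma_ln x + Gamma_fun x).
  refine (is_derive1M_eq (is_derive_id x 1) (is_derive_Gamma_fun x0) _).
  by rewrite mulr1.
have [_ <-] := d1; have [_ <-] := d2.
apply: near_eq_derive.
near=> y; rewrite Gamma_funD1//; near: y; exact: lt_nbhsr.
Unshelve. all: by end_near. Qed.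

(** ln t lies below its tangent at n, and the mean of t under the law with density
    proportional to t ^ (n - 1) exp (- t) is n. *)
Lemma Gamma_ln_nat_le n : (0 < n)%N -> Gamma_ln n%:R <= ln n%:R * Gamma_fun n%:R :> R.
Proof.
move=> n0; have n0' : 0 < n%:R :> R by rewrite ltr0n.
have i1 : -1 < n%:R - 1 :> R by lra.
have i2 : -1 < n%:R + 1 - 1 :> R by lra.
have j1 := integrable_powR_expRN i1; have j2 := integrable_powR_expRN i2.
have -> : ln n%:R * Gamma_fun n%:R =
    (ln n%:R - 1) * Gamma_fun n%:R + n%:R^-1 * Gamma_fun (n%:R + 1) :> R.
  by rewrite Gamma_funD1//; field; rewrite gt_eqF.
rewrite /Gamma_fun /Gamma_ln -!RintegralZl// -RintegralD//; try exact: integrable_EFinZ.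
apply: le_Rintegral => //.
- exact: integrable_powR_ln_expRN.
- by apply: integrable_EFinD => //; apply: integrable_EFinZ.
- move=> t /in_D0 t0; rewrite addrK !mulrA -mulrDl ler_wpM2r ?expR_ge0//.
  have -> : t `^ n%:R = t `^ (n%:R - 1) * t.
    by rewrite -[X in _ * X](powRr1 (ltW t0)) -powRD_gt0// subrK.
  rewrite mulrA mulrAC -mulrDl mulrC ler_wpM2r ?powR_ge0//.
  have := le_ln1Dx (_ : -1 < t / n%:R - 1); rewrite addrCA subrr addr0.
  rewrite ln_div ?posrE// => /(_ _); rewrite [n%:R^-1 * t]mulrC => H.
  suff /H : -1 < t / n%:R - 1 by lra.
  by have := divr_gt0 t0 n0'; lra.
Qed.

(** ln t is at least ln n + 1 - n / t, and the mean of n / t under the law with density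
    proportional to t ^ n exp (- t) is 1. *)
Lemma Gamma_ln_nat_ge n : (0 < n)%N -> ln n%:R * Gamma_fun n.+1%:R <= Gamma_ln n.+1%:R :> R.
Proof.
move=> n0; have n0' : 0 < n%:R :> R by rewrite ltr0n.
rewrite -natr1.
have i1 : -1 < n%:R - 1 :> R by lra.
have i2 : -1 < n%:R + 1 - 1 :> R by lra.
have j1 := integrable_powR_expRN i1; have j2 := integrable_powR_expRN i2.
have -> : ln n%:R * Gamma_fun (n%:R + 1) =
    (ln n%:R + 1) * Gamma_fun (n%:R + 1) + (- n%:R) * Gamma_fun n%:R :> R.
  by rewrite Gamma_funD1//; field.
rewrite /Gamma_fun /Gamma_ln -!RintegralZl// -RintegralD//; try exact: integrable_EFinZ.
apply: le_Rintegral => //.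
- by apply: integrable_EFinD => //; apply: integrable_EFinZ.
- exact: integrable_powR_ln_expRN.
- move=> t /in_D0 t0; rewrite addrK !mulrA -mulrDl ler_wpM2r ?expR_ge0//.
  have -> : t `^ (n%:R - 1) = t `^ n%:R / t.
    by rewrite powRD_gt0// -powR_inv1 ?ltW.
  rewrite mulrCA mulrC -mulrDr ler_wpM2l ?powR_ge0//.
  have := le_ln1Dx (_ : -1 < n%:R / t - 1); rewrite addrCA subrr addr0.
  rewrite ln_div ?posrE// => /(_ _) H.
  suff /H : -1 < n%:R / t - 1 by lra.
  by have := divr_gt0 n0' t0; lra.
Qed.

Lemma digamma_nat n :
  Gamma_ln n.+1%:R / Gamma_fun n.+1%:R = series harmonic n + Gamma_ln 1 :> R.
Proof.
elim: n => [|n IH]; first by rewrite Gamma_fun1 divr1 /series /= big_geq// add0r.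
have n0 : 0 < n.+1%:R :> R by rewrite ltr0n.
rewrite /series /= big_nat_recr//= -/(series harmonic n) addrAC -IH.
rewrite -(natr1 n.+1) Gamma_lnD1// Gamma_funD1//.
have g0 := Gamma_fun_gt0 n0; rewrite /harmonic /=.
move: (n.+1%:R) n0 g0 => N n0 g0.
by field; rewrite !gt_eqF.
Qed.

(** The digamma function at n + 1 is the harmonic sum of order n plus its value at 1,
    and the previous two bounds place it within 1 / n of ln n. *)
Lemma euler_mascheroniE : euler_mascheroni R = - Gamma_ln 1.
Proof.
apply: cvg_lim => //; rewrite -(cvg_shiftS _ _).
apply: (@squeeze_cvgr _ _ _ _ (fun=> - Gamma_ln 1) (fun n => - Gamma_ln 1 + harmonic n)).
- near=> n.
  have n0 : 0 < n.+1%:R :> R by rewrite ltr0n.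
  have g1 : 0 < Gamma_fun n.+1%:R :> R by exact: Gamma_fun_gt0.
  have g2 : 0 < Gamma_fun n.+2%:R :> R by rewrite Gamma_fun_gt0.
  have := @Gamma_ln_nat_le n.+1 isT; rewrite -ler_pdivrMr// digamma_nat.
  have := @Gamma_ln_nat_ge n.+1 isT; rewrite -ler_pdivlMr// digamma_nat.
  rewrite /series /= big_nat_recr//= => H1 H2; apply/andP.
  move: H1 H2; move: (\sum_(0 <= k < n) _) (ln _) (_^-1) (Gamma_ln _) => S l h G H1 H2.
  split; lra.
- exact: cvg_cst.
- rewrite -[X in _ --> X]addr0; apply: cvgD; [exact: cvg_cst|exact: cvg_harmonic].
Unshelve. all: by end_near. Qed.

Lemma Gamma_ln2 : Gamma_ln 2 = 1 - euler_mascheroni R.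
Proof.
by rewrite -[2]natr1 Gamma_lnD1// Gamma_fun1 euler_mascheroniE; ring.
Qed.

Lemma Gamma_ln3 : Gamma_ln 3 = 3 - 2 * euler_mascheroni R.
Proof.
have G2 : Gamma_fun 2 = 1 :> R := Gamma_fun_nat R 1.
by rewrite -[3]natr1 Gamma_lnD1// Gamma_ln2 G2; ring.
Qed.

End GammaLog.

(** * The functions Upsilon and Pi, and the constant varpi *)

Section UpsilonPi.
Variable R : realType.
Notation mu := (@lebesgue_measure R).
Notation D0 := [set` `]0, +oo[ : interval R].
Notation em := (euler_mascheroni R).
Implicit Types x y t rho : R.

Let m0 : measurable (D0 : set (measurableTypeR R)).
Proof. exact: measurable_itv. Qed.

(** The local Lipschitz bound on the integrand, integrated. *)
Lemma continuous_Gamma_ln x : 0 < x -> {for x, continuous (@Gamma_ln R)}.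
Proof.
move=> x0; pose d := x / 6; have d0 : 0 < d by rewrite /d; lra.
pose C := d^-1 ^+ 2 * (Gamma_fun (x + 3 * d) + Gamma_fun (x - 3 * d)).
have C0 : 0 <= C.
  by rewrite mulr_ge0 ?sqr_ge0// addr_ge0// ltW// Gamma_fun_gt0// /d; lra.
suff H h : `|h| <= d -> `|Gamma_ln (x + h) - Gamma_ln x| <= `|h| * C.
  apply/cvgrPdist_le => e e0; near=> z.
  have zd : `|z - x| <= d.
    by rewrite distrC; near: z; exact: cvgr_dist_le.
  have ze : `|z - x| <= e / (C + 1).
    by rewrite distrC; near: z; apply: cvgr_dist_le => //; rewrite divr_gt0//; lra.
  rewrite distrC [X in Gamma_ln X - _](_ : z = x + (z - x)); last by ring.
  apply: le_trans (H _ zd) _.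
  move: ze; rewrite ler_pdivlMr ?ltr_wpDl// => ze.
  by apply: le_trans ze; rewrite mulrDr mulr1 lerDl.
move=> hd; have [hd1 hd2] := ler_normlP _ _ hd.
have I1 : -1 < x - 1 by lra.
have I2 : -1 < x + h - 1 by move: hd1; rewrite /d; lra.
have I3 : -1 < x + 3 * d - 1 by lra.
have I4 : -1 < x - 3 * d - 1 by rewrite /d; lra.
have i3 := integrable_powR_expRN I3; have i4 := integrable_powR_expRN I4.
have i1 := integrable_powR_ln_expRN I1; have i2 := integrable_powR_ln_expRN I2.
have i34 := integrable_EFinD m0 i3 i4.
rewrite /C /Gamma_fun /Gamma_ln -RintegralD// -!RintegralZl//; last first.
  exact: integrable_EFinZ.
rewrite -!RintegralB//.
apply: le_trans (le_normr_Rintegral _ _) _ => //; first exact: integrable_EFinB.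
apply: le_Rintegral => //.
- by apply: integrable_norm; exact: integrable_EFinB.
- by do 2 apply: integrable_EFinZ => //.
- move=> t /in_D0 t0; have := powR_ln_lipschitz (x - 1) d0 hd t0.
  have E := expR_ge0 (- t).
  move=> /(ler_wpM2r E).
  rewrite -[X in _ * X <= _ -> _]ger0_norm// -normrM.
  have -> : x - 1 + h = x + h - 1 by ring.
  have -> : x - 1 + 3 * d = x + 3 * d - 1 by ring.
  have -> : x - 1 - 3 * d = x - 3 * d - 1 by ring.
  rewrite mulrBl => H; apply: le_trans H _.
  by rewrite le_eqVlt; apply/orP; left; apply/eqP; ring.
Unshelve. all: by end_near. Qed.

(** The density of Y ^ (- alpha) under the Frechet-Welsch law, a mixture of the gamma
    laws of shape 2 and 1. *)
Definition FW_density rho t := (rho * t + (1 - rho)) * expR (- t).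

Definition Upsilon_ln rho x :=
  rho * Gamma_ln (x + 2) + (1 - rho) * Gamma_ln (x + 1).

Lemma FW_density_powR rho x t : 0 < t -> t `^ x * FW_density rho t =
  rho * (t `^ (x + 2 - 1) * expR (- t)) + (1 - rho) * (t `^ (x + 1 - 1) * expR (- t)).
Proof.
move=> t0; rewrite addrK (_ : x + 2 - 1 = x + 1); last ring.
by rewrite powRD_gt0// powRr1 ?ltW// /FW_density; ring.
Qed.

Lemma FW_density_powR_ln rho x t : 0 < t -> t `^ x * ln t * FW_density rho t =
  rho * (t `^ (x + 2 - 1) * ln t * expR (- t)) +
  (1 - rho) * (t `^ (x + 1 - 1) * ln t * expR (- t)).
Proof.
move=> t0; rewrite addrK (_ : x + 2 - 1 = x + 1); last ring.
by rewrite powRD_gt0// powRr1 ?ltW// /FW_density; ring.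
Qed.

Lemma integrable_FW_powR rho x : -1 < x ->
  mu.-integrable D0 (EFin \o (fun t => t `^ x * FW_density rho t)).
Proof.
move=> x1; have I1 : -1 < x + 2 - 1 by lra. have I2 : -1 < x + 1 - 1 by lra.
apply: (eq_integrable_EFin m0 (f := fun t => rho * (t `^ (x + 2 - 1) * expR (- t)) +
   (1 - rho) * (t `^ (x + 1 - 1) * expR (- t)))).
  by move=> t /in_D0 /FW_density_powR ->.
by apply: integrable_EFinD => //; apply: integrable_EFinZ => //; exact: integrable_powR_expRN.
Qed.

Lemma integrable_FW_powR_ln rho x : -1 < x ->
  mu.-integrable D0 (EFin \o (fun t => t `^ x * ln t * FW_density rho t)).
Proof.
move=> x1; have I1 : -1 < x + 2 - 1 by lra. have I2 : -1 < x + 1 - 1 by lra.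
apply: (eq_integrable_EFin m0 (f := fun t => rho * (t `^ (x + 2 - 1) * ln t * expR (- t)) +
   (1 - rho) * (t `^ (x + 1 - 1) * ln t * expR (- t)))).
  by move=> t /in_D0 /FW_density_powR_ln ->.
by apply: integrable_EFinD => //; apply: integrable_EFinZ => //; exact: integrable_powR_ln_expRN.
Qed.

Lemma UpsilonE rho x : -1 < x ->
  Upsilon rho x = \int[mu]_(t in `]0, +oo[) (t `^ x * FW_density rho t).
Proof.
move=> x1; have I1 : -1 < x + 2 - 1 by lra. have I2 : -1 < x + 1 - 1 by lra.
under eq_Rintegral => t /[!inE] /in_D0 t0 do rewrite FW_density_powR//.
have j1 := integrable_powR_expRN I1; have j2 := integrable_powR_expRN I2.
by rewrite RintegralD// ?RintegralZl//; exact: integrable_EFinZ.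
Qed.

Lemma Upsilon_lnE rho x : -1 < x ->
  Upsilon_ln rho x = \int[mu]_(t in `]0, +oo[) (t `^ x * ln t * FW_density rho t).
Proof.
move=> x1; have I1 : -1 < x + 2 - 1 by lra. have I2 : -1 < x + 1 - 1 by lra.
under eq_Rintegral => t /[!inE] /in_D0 t0 do rewrite FW_density_powR_ln//.
have j1 := integrable_powR_ln_expRN I1; have j2 := integrable_powR_ln_expRN I2.
by rewrite RintegralD// ?RintegralZl//; exact: integrable_EFinZ.
Qed.

Lemma Upsilon_gt0 rho x : 0 <= rho <= 1 -> -1 < x -> 0 < Upsilon rho x.
Proof.
move=> /andP[r0 r1] x1; have g1 : 0 < Gamma_fun (x + 1) by apply: Gamma_fun_gt0; lra.
have x1' : 0 < x + 1 by lra.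
rewrite /Upsilon (_ : x + 2 = x + 1 + 1); last ring.
rewrite Gamma_funD1// mulrA -mulrDl mulr_gt0//.
have := mulr_ge0 r0 (ltW x1'); nra.
Qed.

Lemma is_derive_shift (f : R -> R) x c a :
  is_derive (x + c) 1 f a -> is_derive x 1 (fun y => f (y + c)) a.
Proof.
move=> df; have ds : is_derive x 1 (fun y => y + c : R) 1.
  by apply: is_derive1D_eq; rewrite addr0.
by refine (@is_derive1_comp_eq _ f (fun y => y + c) _ _ _ _ df ds _); rewrite mulr1.
Qed.

Lemma is_derive_Upsilon rho x : -1 < x ->
  is_derive x 1 (Upsilon rho) (Upsilon_ln rho x).
Proof.
move=> x1; have I1 : 0 < x + 2 by lra. have I2 : 0 < x + 1 by lra.
have d1 := is_derive_shift (is_derive_Gamma_fun I1).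
have d2 := is_derive_shift (is_derive_Gamma_fun I2).
exact: (is_deriveD (is_deriveZ rho d1) (is_deriveZ (1 - rho) d2)).
Qed.

Lemma Pi_funE rho y : 0 < y ->
  Pi_fun rho y = y^-1 - Upsilon_ln rho y / Upsilon rho y + rho / 2 - em.
Proof.
move=> y0; have y1 : -1 < y by lra.
by rewrite /Pi_fun derive1E; have [_ ->] := is_derive_Upsilon rho y1.
Qed.

Lemma continuous_Upsilon rho x : -1 < x -> {for x, continuous (Upsilon rho)}.
Proof. by move=> /(is_derive_Upsilon rho); exact: is_derive1_continuous. Qed.

Lemma continuous_Upsilon_ln rho x : -1 < x -> {for x, continuous (Upsilon_ln rho)}.
Proof.
move=> x1.
have cs c : 0 < x + c -> {for x, continuous (fun y => Gamma_ln (y + c) : R)}.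
  move=> xc; apply: (@continuous_comp _ _ _ (fun y => y + c) (@Gamma_ln R)).
    by apply: cvgD; [exact: cvg_id|exact: cvg_cst].
  exact: continuous_Gamma_ln.
by apply: cvgD; (apply: cvgM; [exact: cvg_cst|apply: cs; lra]).
Qed.

Lemma Pi_fun1_le0 rho : 0 <= rho <= 1 -> Pi_fun rho 1 <= 0.
Proof.
move=> /andP[r0 r1].
have G3 : Gamma_fun 3 = 2 :> R := Gamma_fun_nat R 2.
have G2 : Gamma_fun 2 = 1 :> R := Gamma_fun_nat R 1.
have e3 : 1 + 2 = 3 :> R by ring.
have e2 : 1 + 1 = 2 :> R by ring.
rewrite Pi_funE// /Upsilon_ln /Upsilon e3 e2 G3 G2 Gamma_ln3 Gamma_ln2.
have r1' : rho + 1 != 0 by rewrite gt_eqF//; lra.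
rewrite [leLHS](_ : _ = - (rho * (1 - rho) / (2 * (rho + 1)))).
  rewrite oppr_le0; apply: divr_ge0; first by rewrite mulr_ge0 ?subr_ge0.
  lra.
by field.
Qed.

(** Upsilon is the moment function of a positive measure, hence log-convex. *)
Lemma Upsilon_ratio_le rho a b : 0 <= rho <= 1 -> -1 < a -> a <= b ->
  Upsilon_ln rho a / Upsilon rho a <= Upsilon_ln rho b / Upsilon rho b.
Proof.
move=> r01 a1 ab; have b1 : -1 < b by lra.
have ua := Upsilon_gt0 r01 a1; have ub := Upsilon_gt0 r01 b1.
have [m mE] : exists m, m = Upsilon_ln rho a / Upsilon rho a by eexists.
rewrite -mE (ler_pdivlMr _ _ ub).
have mE' : Upsilon_ln rho a - m * Upsilon rho a = 0.
  by rewrite mE (divfK (lt0r_neq0 ua)) subrr.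
suff : expR ((b - a) * m) * (Upsilon_ln rho a - m * Upsilon rho a) <=
    Upsilon_ln rho b - m * Upsilon rho b.
  by rewrite mE' mulr0 subr_ge0.
have ia := integrable_FW_powR rho a1; have ib := integrable_FW_powR rho b1.
have la := integrable_FW_powR_ln rho a1; have lb := integrable_FW_powR_ln rho b1.
have za := integrable_EFinZ m0 m ia; have zb := integrable_EFinZ m0 m ib.
rewrite !UpsilonE// !Upsilon_lnE// -!RintegralZl// -!RintegralB//.
rewrite -RintegralZl//; last exact: integrable_EFinB.
apply: le_Rintegral => //.
- by apply: integrable_EFinZ => //; exact: integrable_EFinB.
- exact: integrable_EFinB.
move=> t /in_D0 t0.
have w0 : 0 <= FW_density rho t.
  case/andP: r01 => r0 r1; rewrite mulr_ge0 ?expR_ge0// addr_ge0 ?subr_ge0//.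
  by rewrite mulr_ge0// ltW.
have := ler_wpM2r w0 (tilt_ge m (ln t) ab); rewrite -!powR_gt0E// => H.
rewrite [leRHS](_ : _ = (ln t - m) * t `^ b * FW_density rho t); last ring.
by apply: le_trans H; rewrite le_eqVlt; apply/orP; left; apply/eqP; ring.
Qed.

Lemma Pi_fun_decreasing rho a b : 0 <= rho <= 1 -> 0 < a -> a < b ->
  Pi_fun rho b < Pi_fun rho a.
Proof.
move=> r01 a0 ab; have b0 := lt_trans a0 ab.
rewrite !Pi_funE//.
have a1 : -1 < a by lra.
have r := Upsilon_ratio_le r01 a1 (ltW ab).
have v : b^-1 < a^-1 by rewrite ltf_pV2.
by do 2 apply: ltr_leD (lexx _); apply: (ltr_leD v); rewrite lerN2.
Qed.

(** Near 0 the term 1 / y dominates, since the logarithmic derivative of Upsilon is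
    bounded above by its value at 1. *)
Lemma Pi_fun_has_pos rho : 0 <= rho <= 1 -> exists2 a, 0 < a < 1 & 0 < Pi_fun rho a.
Proof.
move=> r01; have l1 : -1 < (1:R) by lra.
set c := Upsilon_ln rho 1 / Upsilon rho 1 - rho / 2 + em.
have n0 := normr_ge0 c; have nc := ler_norm c.
have a0 : 0 < (`|c| + 2)^-1 by rewrite invr_gt0; lra.
have a1 : (`|c| + 2)^-1 < 1 by rewrite invf_lt1; lra.
exists (`|c| + 2)^-1; first by rewrite a0.
rewrite Pi_funE// invrK.
have b1 : -1 < (`|c| + 2)^-1 by lra.
have := Upsilon_ratio_le r01 b1 (ltW a1).
move: (Upsilon_ln rho (_^-1) / _) => y.
have : Upsilon_ln rho 1 / Upsilon rho 1 = c + rho / 2 - em by rewrite /c; ring.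
move: (Upsilon_ln rho 1 / _) nc n0 => x; move: (c) => c'; lra.
Qed.

Lemma continuous_Pi_fun rho y : 0 <= rho <= 1 -> 0 < y ->
  {for y, continuous (Pi_fun rho)}.
Proof.
move=> r01 y0; have y1 : -1 < y by lra.
have u0 := Upsilon_gt0 r01 y1.
have E : \forall z \near y, z^-1 - Upsilon_ln rho z / Upsilon rho z + rho / 2 - em = Pi_fun rho z.
  by near=> z; rewrite Pi_funE//; near: z; exact: lt_nbhsr.
rewrite /continuous_at; apply: cvg_trans (near_eq_cvg E) _.
rewrite Pi_funE//; apply: cvgB; last exact: cvg_cst.
apply: cvgD; last exact: cvg_cst.
apply: cvgB; first by apply: cvgV; [rewrite gt_eqF|exact: cvg_id].
apply: cvgM; first exact: continuous_Upsilon_ln.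
by apply: cvgV; [rewrite gt_eqF|exact: continuous_Upsilon].
Unshelve. all: by end_near. Qed.

Lemma varpi_spec rho : 0 <= rho <= 1 -> 0 < varpi rho /\ Pi_fun rho (varpi rho) = 0.
Proof.
move=> r01; rewrite /varpi; case: xgetP => [y -> //|] nex; exfalso.
have [a /andP[a0 a1] Pa] := Pi_fun_has_pos r01.
have P1 := Pi_fun1_le0 r01.
have [||c /[!in_itv]/= /andP[ac cb] Pc] := @IVT R (Pi_fun rho) a 1 0 (ltW a1).
- apply/(continuous_within_itvP _ a1); split.
  + move=> x /[!in_itv]/= /andP[ax _]; apply: (continuous_Pi_fun r01); exact: lt_trans ax.
  + by apply: cvg_at_right_filter; exact: (continuous_Pi_fun r01).
  + by apply: cvg_at_left_filter; exact: (continuous_Pi_fun r01).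
- apply/andP; split; first by rewrite ge_min; apply/orP; right.
  by rewrite le_max; apply/orP; left; exact: ltW.
- by apply: (nex c); split => //; apply: lt_le_trans ac.
Qed.

Lemma varpi_gt0 rho : 0 <= rho <= 1 -> 0 < varpi rho.
Proof. by move=> /varpi_spec[]. Qed.

(** The position of varpi is read off the sign of Pi at a fixed point, where Pi depends
    on rho through a rational function; measurability and continuity of varpi in rho
    both follow from this. *)
Lemma varpi_gt rho a : 0 <= rho <= 1 -> 0 < a -> (a < varpi rho) = (0 < Pi_fun rho a).
Proof.
move=> r01 a0; have [v0 Pv] := varpi_spec r01.
apply/idP/idP => [av|Pa]; first by rewrite -Pv; exact: Pi_fun_decreasing.
rewrite ltNge; apply/negP; rewrite le_eqVlt => /predU1P[va|va].
  by move: Pa; rewrite -va Pv ltxx.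
by have := lt_trans Pa (Pi_fun_decreasing r01 v0 va); rewrite Pv ltxx.
Qed.

Lemma varpi_lt rho a : 0 <= rho <= 1 -> 0 < a -> (varpi rho < a) = (Pi_fun rho a < 0).
Proof.
move=> r01 a0; have [v0 Pv] := varpi_spec r01.
apply/idP/idP => [av|Pa]; first by rewrite -Pv; exact: Pi_fun_decreasing.
rewrite ltNge; apply/negP; rewrite le_eqVlt => /predU1P[va|va].
  by move: Pa; rewrite va Pv ltxx.
by have := lt_trans (Pi_fun_decreasing r01 a0 va) Pa; rewrite Pv ltxx.
Qed.

End UpsilonPi.

(** * Integration against a density *)

Section Density.
Local Open Scope ereal_scope.
Context d (T : measurableType d) (R : realType).
Variables (nu : {finite_measure set T -> \bar R})
          (mu : {sigma_finite_measure set T -> \bar R}) (h : T -> R).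
Hypothesis mh : measurable_fun [set: T] h.
Hypothesis h0 : forall x, (0 <= h x)%R.
Hypothesis nuE : forall A, measurable A -> nu A = \int[mu]_(x in A) (h x)%:E.

Let numu : nu `<< mu.
Proof.
apply/null_content_dominatesP => A mA muA; rewrite nuE//.
rewrite (_ : \int[mu]_(x in A) (h x)%:E = \int[mu]_(x in A) `|(h x)%:E|).
  by apply: integral_abs_eq0 => //; apply/measurable_EFinP/measurable_funTS.
by apply: eq_integral => x _; rewrite gee0_abs// lee_fin.
Qed.

Let inth : mu.-integrable [set: T] (EFin \o h).
Proof.
apply/integrableP; split; first exact/measurable_EFinP.
under eq_integral do rewrite gee0_abs ?lee_fin//.
by rewrite -nuE// ltey_eq fin_num_measure.
Qed.

Let RN_density E : measurable E -> ae_eq mu E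
  (Radon_Nikodym_SigmaFinite.f nu mu) (EFin \o h).
Proof.
move=> mE; apply: integral_ae_eq => //.
- apply: (integrableS measurableT) => //.
  exact: Radon_Nikodym_SigmaFinite.f_integrable.
- exact: measurable_funTS (measurable_int _ inth).
- by move=> A AE mA; rewrite -nuE// -Radon_Nikodym_SigmaFinite.f_integral.
Qed.

(** The density h is almost everywhere the Radon-Nikodym derivative, because the two
    have the same integrals. *)
Lemma ge0_integral_density E f : measurable E -> measurable_fun E f ->
  (forall x, 0 <= f x) ->
  \int[nu]_(x in E) f x = \int[mu]_(x in E) (f x * (h x)%:E).
Proof.
move=> mE mf f0; rewrite -(Radon_Nikodym_SigmaFinite.change_of_variables numu)//.
apply: ae_eq_integral => //.
- apply: emeasurable_funM => //; apply: (measurable_int mu).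
  apply: (integrableS measurableT) => //.
  exact: Radon_Nikodym_SigmaFinite.f_integrable.
- by apply: emeasurable_funM => //; apply: measurable_funTS; exact/measurable_EFinP.
- by apply: ae_eqe_mul2l => /=; exact: RN_density.
Qed.

Lemma integrable_density E (f : T -> R) : measurable E -> measurable_fun E f ->
  mu.-integrable E (EFin \o (fun x => (f x * h x)%R)) ->
  nu.-integrable E (EFin \o f).
Proof.
move=> mE mf /integrableP[_ intf]; apply/integrableP; split.
  exact/measurable_EFinP.
rewrite ge0_integral_density//; last first.
  by apply: measurableT_comp => //; exact/measurable_EFinP.
apply: le_lt_trans intf; rewrite le_eqVlt; apply/orP; left; apply/eqP.
by apply: eq_integral => x _ /=; rewrite normrM EFinM [X in _ = _ * X%:E]ger0_norm.
Qed.

Lemma Rintegral_density E (f : T -> R) : measurable E -> measurable_fun E f ->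
  mu.-integrable E (EFin \o (fun x => (f x * h x)%R)) ->
  (\int[nu]_(x in E) f x = \int[mu]_(x in E) (f x * h x))%R.
Proof.
move=> mE mf intf; congr fine.
have mEf : measurable_fun E (EFin \o f) by exact/measurable_EFinP.
have H g : measurable_fun E g -> (forall x, 0 <= g x) ->
  \int[nu]_(x in E) g x = \int[mu]_(x in E) (g x * (h x)%:E).
  exact: ge0_integral_density.
rewrite integralE [RHS]integralE; congr (_ - _).
- rewrite H//; last exact: measurable_funepos.
  apply: eq_integral => x _; rewrite !funeposE /= EFinM.
  by rewrite maxe_pMl ?mul0e// lee_fin.
- rewrite H//; last exact: measurable_funeneg.
  apply: eq_integral => x _; rewrite !funenegE /= -mulNr.
  by rewrite maxe_pMl ?mul0e ?lee_fin.
Qed.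

End Density.

(** * The law with density (rho t + 1 - rho) exp (- t) *)

Section FWLaw.
Variables (R : realType) (rho : R).
Hypothesis rho01 : 0 <= rho <= 1.
Notation mu := (@lebesgue_measure R).
Notation D0 := [set` `]0, +oo[ : interval R].

Let m0 : measurable (D0 : set (measurableTypeR R)).
Proof. exact: measurable_itv. Qed.

Definition FW_pdf : measurableTypeR R -> R := FW_density rho \_ D0.

Lemma FW_density_ge0 t : 0 <= t -> 0 <= FW_density rho t.
Proof.
move=> t0; case/andP: rho01 => r0 r1.
by rewrite mulr_ge0 ?expR_ge0// addr_ge0 ?subr_ge0// mulr_ge0.
Qed.

Lemma FW_pdf_ge0 t : 0 <= FW_pdf t.
Proof.
rewrite /FW_pdf patchE; case: ifPn => // /[!inE] /in_D0 t0.
exact/FW_density_ge0/ltW.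
Qed.

Lemma continuous_FW_density : continuous (FW_density rho).
Proof.
move=> t; apply: cvgM; last exact: continuous_expRN.
by apply: cvgD; [apply: cvgM; [exact: cvg_cst|exact: cvg_id]|exact: cvg_cst].
Qed.

Lemma measurable_FW_pdf : measurable_fun [set: measurableTypeR R] FW_pdf.
Proof.
apply/(measurable_restrict _ m0) => //; rewrite setTI.
by apply: continuous_gt0_measurable => t _; exact: continuous_FW_density.
Qed.

Lemma integral_FW_pdf_gt0 : (\int[mu]_(t in D0) (FW_pdf t)%:E = 1)%E.
Proof.
have i0 : -1 < 0 :> R by lra.
have := UpsilonE rho i0; have := integrable_FW_powR rho i0.
rewrite /Upsilon !add0r Gamma_fun1 (Gamma_fun_nat R 1).
rewrite (_ : 1`! = 1)%N// mulr1 mulr1 addrC subrK => I E.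
rewrite (_ : (\int[mu]_(t in D0) (FW_pdf t)%:E)%E =
  (\int[mu]_(t in D0) (t `^ 0 * FW_density rho t)%:E)%E); last first.
  apply: eq_integral => t tD; rewrite /FW_pdf patchE tD.
  by rewrite powRr0 mul1r.
rewrite -[LHS]fineK; first exact: (esym (congr1 EFin E)).
exact: integrable_fin_num I.
Qed.

Definition FW_law (A : set (measurableTypeR R)) : \bar R :=
  (\int[mu]_(t in A) (FW_pdf t)%:E)%E.

Let FW_law0 : FW_law set0 = 0%E.
Proof. by rewrite /FW_law integral_set0. Qed.

Let FW_law_ge0 A : (0 <= FW_law A)%E.
Proof. by apply: integral_ge0 => t _; rewrite lee_fin FW_pdf_ge0. Qed.

Let FW_law_sigma_additive : semi_sigma_additive FW_law.
Proof.
move=> /= F mF tF mUF; rewrite /FW_law; apply: cvg_toP.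
  apply: ereal_nondecreasing_is_cvgn => m n mn.
  by apply: lee_sum_nneg_natr => // k _ _; exact: FW_law_ge0.
rewrite ge0_integral_bigcup//=.
- apply/measurable_funTS/measurableT_comp => //.
  exact: measurable_FW_pdf.
- by move=> x _; rewrite lee_fin FW_pdf_ge0.
Qed.

HB.instance Definition _ := isMeasure.Build _ _ _
  FW_law FW_law0 FW_law_ge0 FW_law_sigma_additive.

Lemma FW_law_tail t : 0 < t ->
  FW_law [set` `[t, +oo[ : interval R] = (expR (- t) * (1 + rho * t))%:E.
Proof.
move=> t0; rewrite /FW_law.
rewrite (_ : (\int[mu]_(x in `[t, +oo[) (FW_pdf x)%:E)%E =
  (\int[mu]_(x in `[t, +oo[) (FW_density rho x)%:E)%E); last first.
  apply: eq_integral => x /[!inE] /=; rewrite in_itv /= andbT => tx.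
  by rewrite /FW_pdf patchE ifT// inE /= in_itv /= andbT (lt_le_trans t0).
pose F x := - (expR (- x) * (1 + rho * x)).
have dF (x : R) : is_derive x 1 F (FW_density rho x).
  have dl : is_derive x 1 (fun y => 1 + rho * y) rho.
    by apply: is_derive1D_eq; rewrite add0r /GRing.scale /= mulr1.
  have dM : is_derive x 1 (fun y => expR (- y) * (1 + rho * y)) (- FW_density rho x).
    refine (is_derive1M_eq (is_derive1_expRN x) dl _).
    by rewrite /FW_density; ring.
  by rewrite -[FW_density rho x]opprK; apply: is_deriveN.
rewrite (@ge0_continuous_FTC2y _ _ F t 0).
- by rewrite /F EFinN oppeK add0e.
- by move=> x tx; apply: FW_density_ge0; exact: le_trans (ltW t0) tx.
- by apply: continuous_subspaceT; exact: continuous_FW_density.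
- rewrite -[X in _ --> X]oppr0; apply: cvgN.
  have H : x `^ 0 * expR (- x) + rho * (x `^ 1 * expR (- x)) @[x --> +oo] --> (0 : R).
    rewrite -[X in _ --> X](addr0 (0:R)); apply: cvgD.
      by under eq_fun do rewrite powRr0 mul1r; exact: cvgr_expR.
    rewrite -[X in _ --> X](mulr0 rho); apply: cvgM; first exact: cvg_cst.
    exact: cvg_powR_expRN_y.
  apply: cvg_trans H; apply: near_eq_cvg; near=> x.
  rewrite powRr0 powRr1; first by ring.
  by near: x; exact: nbhs_pinfty_ge.
- by move=> x _; have [] := dF x.
- by apply: cvg_at_right_filter; exact: (is_derive1_continuous (dF t)).
- by move=> x _; rewrite derive1E; have [_ ->] := dF x.
Unshelve. all: by end_near. Qed.

Lemma FW_law_tail_le0 t : t <= 0 -> FW_law [set` `[t, +oo[ : interval R] = 1%E.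
Proof.
move=> t0; rewrite -integral_FW_pdf_gt0 /FW_law integral_mkcond.
rewrite [RHS]integral_mkcond; apply: eq_integral => x _.
rewrite !patchE; case: ifPn; case: ifPn => // /=.
- by rewrite /FW_pdf patchE => /negbTE ->.
- rewrite !inE /= !in_itv /= !andbT => x0 /negP; rewrite inE /= in_itv /= andbT => tx.
  by exfalso; apply: tx; apply: le_trans t0 (ltW x0).
Qed.

Section Transfer.
Context d (Om : measurableType d) (P : probability Om R).
Variable T : {mfun Om >-> measurableTypeR R}.
Hypothesis T_ge0 : forall w, 0 <= T w.
Hypothesis T_tail : forall t, 0 < t ->
  P [set w | t <= T w] = (expR (- t) * (1 + rho * t))%:E.

(** Closed half-lines form a pi-system generating the Borel sets. *)
Lemma distribution_FW (A : set (measurableTypeR R)) :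
  measurable A -> distribution P T A = FW_law A.
Proof.
pose m1 : {measure set (measurableTypeR R) -> \bar R} := distribution P T.
pose m2 : {measure set (measurableTypeR R) -> \bar R} := FW_law.
apply: (@measure_unique _ R (measurableTypeR R) (@RGenCInfty.G R) (fun k => `[- k%:R, +oo[%classic) _ _ _ _ m1 m2).
- exact: RGenCInfty.measurableE.
- move=> _ _ [x ->] [y ->]; exists (Order.max x y).
  apply/seteqP; split => z /=; rewrite !in_itv /= !andbT ge_max.
    by move=> [-> ->].
  by move=> /andP.
- by move=> k; exists (- k%:R).
- apply/seteqP; split => // x _; exists (Num.truncn `|x|).+1 => //=.
  rewrite in_itv /= andbT lerNl; apply: le_trans (ler_norm _) _; rewrite normrN.
  exact/ltW/truncnS_gt.
- move=> _ [t ->].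
  have -> : m1 `[t, +oo[%classic = P [set w | t <= T w].
    by congr (P _); apply/seteqP; split => w /=; rewrite in_itv /= andbT.
  have [t0|t0] := ltP 0 t; first by rewrite T_tail// -FW_law_tail.
  rewrite (FW_law_tail_le0 t0 : m2 _ = _) (_ : [set w | _] = setT) ?probability_setT//.
  by apply/seteqP; split => // w _ /=; exact: le_trans t0 (T_ge0 w).
- by move=> k; apply: le_lt_trans (probability_le1 _ _) (ltry _); exact: measurable_itv.
Qed.

(** A nonnegative variable with tail exp (- t) (1 + rho t) has the law above, and
    expectations become integrals over the half-line. *)
Lemma FW_transfer (f : R -> R) :
  measurable_fun [set: measurableTypeR R] f ->
  mu.-integrable D0 (EFin \o (fun t => f t * FW_density rho t)) ->
  P.-integrable (T @^-1` D0) (EFin \o (f \o T)) /\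
  \int[P]_(w in T @^-1` D0) f (T w) = \int[mu]_(t in D0) (f t * FW_density rho t).
Proof.
move=> mf intf.
have mfD : measurable_fun D0 f by exact: measurable_funTS.
have intf' : mu.-integrable D0 (EFin \o (fun t => f t * FW_pdf t)).
  apply: (eq_integrable_EFin m0 _ intf) => t tD.
  by rewrite /FW_pdf patchE mem_set.
have iD := integrable_density measurable_FW_pdf FW_pdf_ge0 distribution_FW m0 mfD intf'.
have RD := Rintegral_density measurable_FW_pdf FW_pdf_ge0 distribution_FW m0 mfD intf'.
have mEf : measurable_fun [set: measurableTypeR R] (EFin \o f) by exact/measurable_EFinP.
have mT : measurable_fun [set: Om] T by exact: measurable_funP.
have mTD : measurable (T @^-1` D0) by rewrite -[X in measurable X]setTI; exact: mT.
have iP : P.-integrable (T @^-1` D0) (EFin \o (f \o T)).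
  apply/integrableP; split.
    by apply: measurable_funTS; exact: measurableT_comp mEf mT.
  have /integrableP[_] := iD; rewrite ge0_integral_pushforward//.
  by apply: measurable_funTS; exact: measurableT_comp.
split=> //; rewrite (_ : \int[mu]_(t in D0) (f t * FW_density rho t) =
    \int[mu]_(t in D0) (f t * FW_pdf t)); last first.
  by apply: eq_Rintegral => t tD; rewrite /FW_pdf patchE tD.
rewrite -RD; congr fine; symmetry.
exact: (integral_pushforward mT mEf iP m0).
Qed.

End Transfer.
End FWLaw.

(** * The marginals of the Frechet-Welsch law *)

Section Population.
Variable R : realType.
Notation mu := (@lebesgue_measure R).
Notation D0 := [set` `]0, +oo[ : interval R].
Notation Q := (@pos_quadrant R).
Variable rho : R -> R.
Hypothesis rhoC : class_C rho.
Variable alpha0 : R.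
Hypothesis alpha0_gt0 : 0 < alpha0.
Variable H : probability (R * R)%type R.
Hypothesis HE : frechet_welsch rho alpha0 1 H.

Lemma class_C_itv01 : 0 <= rho 0 <= 1.
Proof.
have [_ _ /(_ 0)] := rhoC; rewrite subr0; apply.
by rewrite in_itv /= lexx ler01.
Qed.

(** A concave function on [0, 1] lies above its chord; together with monotonicity this
    forces continuity at 0. *)
Lemma class_C_chord eta : 0 <= eta <= 1 -> (1 - eta) * rho 0 <= rho eta <= rho 0.
Proof.
move=> /andP[e0 e1]; have [cvx ninc bd] := rhoC.
have in0 : 0 \in [set` `[0, 1] : interval R] by rewrite inE /= in_itv /= lexx ler01.
have in1 : 1 \in [set` `[0, 1] : interval R] by rewrite inE /= in_itv /= lexx ler01.
apply/andP; split; last first.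
  by apply: ninc => //; rewrite in_itv /= ?e0 ?lexx ?ler01.
have := cvx (Itv01 e0 e1) 1 0 in1 in0; rewrite !convRE /=.
rewrite [X in - rho X <= _](_ : _ = eta); last first.
  by rewrite -[LHS]/(eta * 1 + unstable.onem eta * 0) mulr1 mulr0 addr0.
rewrite /unstable.onem.
have := bd 1; rewrite in_itv /= lexx ler01 subrr => /(_ isT) r1.
have -> : rho 1 = 0 by apply/eqP; rewrite eq_le andbC.
rewrite oppr0 mulr0 add0r; lra.
Qed.

Lemma class_C_cvg (e : nat -> R) : (\forall n \near \oo, 0 <= e n <= 1) ->
  e n @[n --> \oo] --> 0 -> rho (e n) @[n --> \oo] --> rho 0.
Proof.
move=> e01 e0; apply: (@squeeze_cvgr _ _ _ _ (fun n => (1 - e n) * rho 0) (fun=> rho 0)).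
- by near=> n; apply: class_C_chord; near: n.
- rewrite -[X in _ --> X](_ : (1 - 0) * rho 0 = rho 0); last by rewrite subr0 mul1r.
  by apply: cvgM; [apply: cvgB => //; exact: cvg_cst|exact: cvg_cst].
- exact: cvg_cst.
Unshelve. all: by end_near. Qed.

Lemma measurable_fst_le x : measurable [set p : R * R | p.1 <= x].
Proof.
rewrite (_ : [set p | _] = setT `&` fst @^-1` `]-oo, x]); last first.
  by apply/seteqP; split => p /=; rewrite in_itv /=; [|case].
by apply: measurable_fst => //; exact: measurable_itv.
Qed.

Lemma measurable_snd_le y : measurable [set p : R * R | p.2 <= y].
Proof.
rewrite (_ : [set p | _] = setT `&` snd @^-1` `]-oo, y]); last first.
  by apply/seteqP; split => p /=; rewrite in_itv /=; [|case].
by apply: measurable_snd => //; exact: measurable_itv.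
Qed.

Lemma measurable_pos_quadrant : measurable Q.
Proof.
rewrite (_ : Q = (setT `&` fst @^-1` D0) `&` (setT `&` snd @^-1` D0)); last first.
  by apply/seteqP; split => p /=; rewrite !in_itv /= !andbT; [case|case=> -[_ ?] []].
apply: measurableI; [apply: measurable_fst|apply: measurable_snd] => //; exact: measurable_itv.
Qed.

Lemma H_setIQ A : measurable A -> H (Q `&` A) = H A.
Proof.
have mQ := measurable_pos_quadrant; have [HQ _] := HE.
move=> mA; have HC : H (~` Q) = 0%E.
  by rewrite probability_setC// HQ subee.
have H0 : H (A `\` Q) = 0%E.
  apply: (@subset_measure0 _ _ _ _ _ (~` Q)) => //.
  - exact: measurableD.
  - exact: measurableC.
transitivity (H (A `\` Q) + H (A `&` Q))%E; first by rewrite H0 add0e setIC.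
by symmetry; exact: measureDI.
Qed.

(** The cdf of Y is the limit of the joint cdf as x tends to infinity, where the
    argument of rho tends to 0. *)
Lemma marginal_snd y : 0 < y ->
  H [set p | p.2 <= y] = (expR (- y `^ (- alpha0)) * (1 + rho 0 * y `^ (- alpha0)))%:E.
Proof.
move=> y0; have [_ cdf] := HE.
pose A n : set (R * R) := [set p | p.1 <= n.+1%:R /\ p.2 <= y].
have mA n : measurable (A n).
  exact: measurableI (measurable_fst_le _) (measurable_snd_le _).
have AU : \bigcup_n A n = [set p | p.2 <= y].
  apply/seteqP; split => [p [n _ []//]|p /= py].
  exists (Num.truncn `|p.1|) => //; split => //=.
  by rewrite (le_trans (ler_norm _))// ltW// truncnS_gt.
have Acvg : H (A n) @[n --> \oo] --> H [set p | p.2 <= y].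
  rewrite -AU; apply: nondecreasing_cvg_mu => //.
    by rewrite AU; exact: measurable_snd_le.
  move=> m n mn; apply/subsetPset => p [pm py]; split => //.
  by apply: le_trans pm _; rewrite ler_nat.
apply: (cvg_unique _ Acvg) => //.
have E n : H (A n) = (FW_cdf rho alpha0 1 n.+1%:R y)%:E by apply: cdf; rewrite ?ltr0n.
rewrite (funext E); apply: cvg_EFin; first exact: nearW.
set t := y `^ (- alpha0).
pose e n := (y / n.+1%:R) `^ alpha0.
have e01 : \forall n \near \oo, 0 <= e n <= 1.
  near=> n; rewrite /e powR_ge0/= -[leRHS](_ : 1 `^ alpha0 = 1); last by rewrite powR1.
  have yn : y <= n%:R by near: n; exact: nbhs_infty_ger.
  apply: ge0_ler_powR; rewrite ?nnegrE ?divr_ge0 ?(ltW y0) ?(ltW alpha0_gt0)//.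
  by rewrite ler_pdivrMr ?ltr0n// mul1r (le_trans yn)// ler_nat.
have e0 : e n @[n --> \oo] --> 0.
  have yn : y / n.+1%:R @[n --> \oo] --> 0.
    by rewrite -[X in _ --> X](mulr0 y); apply: cvgM; [exact: cvg_cst|exact: cvg_harmonic].
  move/cvg_at_rightP : (powR_cvg0 alpha0_gt0); apply; split => // n.
  by rewrite divr_gt0// ltr0n.
have lim : expR (- t) * (1 + rho (e n) * t) @[n --> \oo] --> expR (- t) * (1 + rho 0 * t).
  apply: cvgM; first exact: cvg_cst.
  apply: cvgD; first exact: cvg_cst.
  by apply: cvgM; [exact: class_C_cvg|exact: cvg_cst].
apply: cvg_trans lim; apply: near_eq_cvg; near=> n.
rewrite /= /FW_cdf !divr1 ifF//; apply/negbTE; rewrite -ltNge.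
have yn : y <= n%:R by near: n; exact: nbhs_infty_ger.
by rewrite (le_lt_trans yn)// ltr_nat.
Unshelve. all: by end_near. Qed.

Lemma marginal_fst x : 0 < x ->
  H [set p | p.1 <= x] = (expR (- x `^ (- alpha0)))%:E.
Proof.
move=> x0; have [_ cdf] := HE.
pose A n : set (R * R) := [set p | p.1 <= x /\ p.2 <= n.+1%:R].
have mA n : measurable (A n).
  exact: measurableI (measurable_fst_le _) (measurable_snd_le _).
have AU : \bigcup_n A n = [set p | p.1 <= x].
  apply/seteqP; split => [p [n _ []//]|p /= py].
  exists (Num.truncn `|p.2|) => //; split => //=.
  by rewrite (le_trans (ler_norm _))// ltW// truncnS_gt.
have Acvg : H (A n) @[n --> \oo] --> H [set p | p.1 <= x].
  rewrite -AU; apply: nondecreasing_cvg_mu => //.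
    by rewrite AU; exact: measurable_fst_le.
  move=> m n mn; apply/subsetPset => p [pm py]; split => //.
  by apply: le_trans py _; rewrite ler_nat.
apply: (cvg_unique _ Acvg) => //.
apply: cvg_near_cst; near=> n.
rewrite cdf ?ltr0n// /FW_cdf divr1 ifT//.
rewrite (@le_trans _ _ n%:R)// ?ler_nat//.
by near: n; exact: nbhs_infty_ger.
Unshelve. all: by end_near. Qed.

End Population.

(** * Moments of the Frechet-Welsch law *)

Section PopulationMoments.
Variable R : realType.
Notation mu := (@lebesgue_measure R).
Notation D0 := [set` `]0, +oo[ : interval R].
Notation Q := (@pos_quadrant R).
Notation em := (euler_mascheroni R).
Variable rho : R -> R.
Hypothesis rhoC : class_C rho.
Variable alpha0 : R.
Hypothesis alpha0_gt0 : 0 < alpha0.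
Variable H : probability (R * R)%type R.
Hypothesis HE : frechet_welsch rho alpha0 1 H.

Section Marginal.
Variables (X : R * R -> R) (r : R).
Hypothesis r01 : 0 <= r <= 1.
Hypothesis mX : measurable_fun [set: R * R] X.
Hypothesis X_gt0 : forall p, Q p -> 0 < X p.
Hypothesis X_cdf : forall x, 0 < x ->
  H [set p | X p <= x] = (expR (- x `^ (- alpha0)) * (1 + r * x `^ (- alpha0)))%:E.

Let T : R * R -> measurableTypeR R := (fun p => X p `^ (- alpha0)) \_ Q.

Let mT : measurable_fun [set: R * R] T.
Proof.
have mQ := @measurable_pos_quadrant R.
apply/(measurable_restrict _ mQ) => //; rewrite setTI; apply: measurable_funTS.
exact: measurableT_comp (measurable_powR _) mX.
Qed.

Let TE p : Q p -> T p = X p `^ (- alpha0).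
Proof. by move=> Qp; rewrite /T patchE mem_set. Qed.

Let T_preimage : T @^-1` D0 = Q.
Proof.
apply/seteqP; split => p /=; rewrite in_itv /= andbT.
  by rewrite /T patchE; case: ifPn => [/[!inE]//|_]; rewrite ltxx.
by move=> Qp; rewrite TE// powR_gt0// X_gt0.
Qed.

(** The variable X ^ (- alpha0) is replaced by 0 off the quadrant, where X need not be
    positive; its preimage of the half-line is then the quadrant itself. *)
Lemma marginal_transfer (f : R -> R) :
  measurable_fun [set: measurableTypeR R] f ->
  mu.-integrable D0 (EFin \o (fun t => f t * FW_density r t)) ->
  \int[H]_(p in Q) f (X p `^ (- alpha0)) = \int[mu]_(t in D0) (f t * FW_density r t).
Proof.
move=> mf intf.
pose Tm : {mfun (R * R)%type >-> measurableTypeR R} := mfun_Sub (mem_set mT).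
have Tm0 p : 0 <= Tm p.
  by rewrite /= /T patchE; case: ifPn => // _; rewrite powR_ge0.
have Tmt t : 0 < t -> H [set p | t <= Tm p] = (expR (- t) * (1 + r * t))%:E.
  move=> t0; pose x := t `^ (- alpha0^-1).
  have x0 : 0 < x by rewrite powR_gt0.
  have xt : x `^ (- alpha0) = t.
    by rewrite /x -powRrM mulrNN mulVf ?gt_eqF// powRr1// ltW.
  rewrite -[in RHS]xt -X_cdf// -(H_setIQ HE (A := [set p | X p <= x])); last first.
    rewrite (_ : [set p | X p <= x] = setT `&` X @^-1` `]-oo, x]); last first.
      by apply/seteqP; split => [p Xp|p [_]]; [split => //|]; rewrite /= in_itv /=.
    by apply: mX => //; exact: measurable_itv.
  congr (H _); apply/seteqP; split => p /=.
    rewrite /T patchE; case: ifPn => [/[!inE] Qp|_]; last by rewrite leNgt t0.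
    move=> tX; split => //; have Xp := X_gt0 Qp.
    have : (X p `^ (- alpha0)) `^ (- alpha0^-1) <= t `^ (- alpha0^-1).
      rewrite !(powRN _ (alpha0^-1)) lef_pV2 ?posrE ?powR_gt0//.
      by apply: ge0_ler_powR; rewrite ?nnegrE ?powR_ge0 ?invr_ge0 ?(ltW alpha0_gt0) ?(ltW t0) ?(ltW Xp) ?(ltW x0).
    by rewrite -powRrM mulrNN mulfV ?gt_eqF// powRr1// ltW.
  move=> [Qp Xx]; have Xp := X_gt0 Qp; rewrite TE// -xt !powRN.
  rewrite lef_pV2 ?posrE ?powR_gt0//.
  by apply: ge0_ler_powR; rewrite ?nnegrE ?powR_ge0 ?invr_ge0 ?(ltW alpha0_gt0) ?(ltW t0) ?(ltW Xp) ?(ltW x0).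
have [iH EH] := FW_transfer r01 Tm0 Tmt mf intf.
rewrite -EH /= T_preimage; apply: eq_Rintegral => p /[!inE] Qp.
by rewrite /= TE.
Qed.

Lemma marginal_powR a : 0 < a ->
  \int[H]_(p in Q) X p `^ (- a) = Upsilon r (a / alpha0).
Proof.
move=> a0; have a1 : -1 < a / alpha0 by have := divr_gt0 a0 alpha0_gt0; lra.
rewrite (UpsilonE _ a1) -(@marginal_transfer (fun t => t `^ (a / alpha0))).
- apply: eq_Rintegral => p _; rewrite -powRrM; congr (_ `^ _).
  by field; rewrite gt_eqF.
- exact: (measurable_powR (a / alpha0)).
- exact: integrable_FW_powR.
Qed.

(** The case a = 0 is the expectation of ln X. *)
Lemma marginal_powR_ln a : 0 <= a ->
  \int[H]_(p in Q) (X p `^ (- a) * ln (X p)) = - Upsilon_ln r (a / alpha0) / alpha0.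
Proof.
move=> a0; have a1 : -1 < a / alpha0 by have := divr_ge0 a0 (ltW alpha0_gt0); lra.
have I := integrable_FW_powR_ln r a1.
rewrite [RHS](_ : _ = (- 1 / alpha0) * Upsilon_ln r (a / alpha0)); last by ring.
rewrite Upsilon_lnE// -RintegralZl//.
transitivity (\int[mu]_(t in D0) (- 1 / alpha0 * (t `^ (a / alpha0) * ln t) *
  FW_density r t)); last by apply: eq_Rintegral => t _; rewrite mulrA.
rewrite -marginal_transfer//.
- apply: eq_Rintegral => p _; rewrite -powRrM ln_powR.
  rewrite (_ : - alpha0 * (a / alpha0) = - a); last by field; rewrite gt_eqF.
  by field; rewrite gt_eqF.
- apply: measurable_funM => //; apply: measurable_funM; first exact: (measurable_powR (a / alpha0)).
  exact: measurable_ln.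
- have mD : measurable (D0 : set (measurableTypeR R)) by exact: measurable_itv.
  by apply: (eq_integrable_EFin mD _ (integrable_EFinZ mD (- 1 / alpha0) I)) => t _ /=; ring.
Qed.

End Marginal.

Lemma Upsilon_ln0 r : Upsilon_ln r 0 = r - em.
Proof.
by rewrite /Upsilon_ln !add0r Gamma_ln2 euler_mascheroniE; ring.
Qed.

Let X2cdf x : 0 < x ->
  H [set p | p.2 <= x] = (expR (- x `^ (- alpha0)) * (1 + rho 0 * x `^ (- alpha0)))%:E.
Proof. exact: marginal_snd. Qed.

Lemma population_powR a : 0 < a ->
  \int[H]_(p in Q) p.2 `^ (- a) = Upsilon (rho 0) (a / alpha0).
Proof.
apply: (@marginal_powR snd) => //; [exact: class_C_itv01|by move=> p []].
Qed.

Lemma population_powR_ln a : 0 < a ->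
  \int[H]_(p in Q) (p.2 `^ (- a) * ln p.2) = - Upsilon_ln (rho 0) (a / alpha0) / alpha0.
Proof.
move=> /ltW; apply: (@marginal_powR_ln snd) => //; [exact: class_C_itv01|by move=> p []].
Qed.

Lemma population_ln_snd : \int[H]_(p in Q) ln p.2 = - (rho 0 - em) / alpha0.
Proof.
rewrite -Upsilon_ln0 -[X in Upsilon_ln _ X](mul0r alpha0^-1).
rewrite -(@marginal_powR_ln snd) => //; [|exact: class_C_itv01|by move=> p []].
by apply: eq_Rintegral => p _; rewrite oppr0 powRr0 mul1r.
Qed.

Lemma population_ln_fst : \int[H]_(p in Q) ln p.1 = em / alpha0.
Proof.
have -> : em / alpha0 = - Upsilon_ln 0 (0 / alpha0) / alpha0.
  by rewrite mul0r Upsilon_ln0 sub0r opprK.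
have r01 : 0 <= (0 : R) <= 1 by rewrite lexx ler01.
have cdf x : 0 < x ->
    H [set p | p.1 <= x] = (expR (- x `^ (- alpha0)) * (1 + 0 * x `^ (- alpha0)))%:E.
  by move=> x0; rewrite mul0r addr0 mulr1; exact: (marginal_fst HE).
have pos (p : R * R) : Q p -> 0 < p.1 by case.
rewrite -(marginal_powR_ln r01 (@measurable_fst _ _ _ _) pos cdf)//.
by apply: eq_Rintegral => p _; rewrite oppr0 powRr0 mul1r.
Qed.

End PopulationMoments.

(** * Empirical means and the profile score *)

Section EmpiricalMean.
Variables (R : realType) (T : eqType).
Implicit Types (f g : T -> R) (z : seq T).

Definition emp f z : R := (size z)%:R^-1 * \sum_(p <- z) f p.

Lemma eq_emp f g z : {in z, f =1 g} -> emp f z = emp g z.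
Proof. by move=> fg; congr (_ * _); exact: eq_big_seq. Qed.

Lemma empD f g z : emp (fun p => f p + g p) z = emp f z + emp g z.
Proof. by rewrite /emp big_split /= mulrDr. Qed.

Lemma empZ c f z : emp (fun p => c * f p) z = c * emp f z.
Proof. by rewrite /emp -mulr_sumr mulrCA. Qed.

Lemma emp_cst c z : (0 < size z)%N -> emp (fun=> c) z = c.
Proof.
move=> z0; rewrite /emp big_const_seq count_predT iter_addr_0 -[c *+ _]mulr_natl.
by rewrite mulKf// pnatr_eq0 -lt0n.
Qed.

Lemma le_emp f g z : {in z, forall p, f p <= g p} -> emp f z <= emp g z.
Proof.
move=> fg; rewrite /emp ler_wpM2l ?invr_ge0//.
by rewrite big_seq [leRHS]big_seq; apply: ler_sum.
Qed.

Lemma emp_gt0 f z : (0 < size z)%N -> {in z, forall p, 0 < f p} -> 0 < emp f z.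
Proof.
case: z => // p z _ f0; rewrite /emp mulr_gt0 ?invr_gt0 ?ltr0n// big_cons.
rewrite ltr_pwDl ?f0 ?mem_head// big_seq sumr_ge0// => q qz.
by rewrite ltW// f0// inE qz orbT.
Qed.

Lemma emp_ge_term f z q : {in z, forall p, 0 <= f p} -> q \in z ->
  f q <= (size z)%:R * emp f z.
Proof.
move=> f0 qz; rewrite /emp mulVKf; last by case: z qz {f0} => // *; rewrite pnatr_eq0.
rewrite (big_rem q)//= lerDl big_seq sumr_ge0// => p /mem_rem; exact: f0.
Qed.

Lemma emp_map (U : eqType) (h : U -> T) f (z : seq U) :
  emp f [seq h p | p <- z] = (size z)%:R^-1 * \sum_(p <- z) f (h p).
Proof. by rewrite /emp size_map big_map. Qed.

End EmpiricalMean.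

Section Score.
Variable R : realType.
Implicit Types (z : seq (R * R)) (a b s : R) (p : R * R).

Definition emp_powR a z := emp (fun p => p.2 `^ (- a)) z.
Definition emp_powR_ln a z := emp (fun p => p.2 `^ (- a) * ln p.2) z.
Definition emp_ln z := emp (fun p => ln p.1) z + emp (fun p => ln p.2) z.
Definition score a z := a^-1 + emp_powR_ln a z / emp_powR a z - emp_ln z / 2.

Definition admissible z := {in z, forall p, 0 < p.2 /\ p.2 <= p.1}.

Lemma emp_powR_gt0 a z : (0 < size z)%N -> admissible z -> 0 < emp_powR a z.
Proof. by move=> z0 zP; apply: emp_gt0 => // p /zP[p0 _]; rewrite powR_gt0. Qed.

(** The moment function of the empirical law of 1 / y is log-convex. *)
Lemma emp_ratio_le a b z : (0 < size z)%N -> admissible z -> a <= b ->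
  emp_powR_ln b z / emp_powR b z <= emp_powR_ln a z / emp_powR a z.
Proof.
move=> z0 zP ab; have A0 := emp_powR_gt0 a z0 zP; have B0 := emp_powR_gt0 b z0 zP.
have [m mE] : exists m, m = - (emp_powR_ln a z / emp_powR a z) by eexists.
rewrite -[leRHS]opprK -mE ler_pdivrMr//.
have mE' : - emp_powR_ln a z - m * emp_powR a z = 0.
  by rewrite mE; field; rewrite gt_eqF.
suff : expR ((b - a) * m) * (- emp_powR_ln a z - m * emp_powR a z) <=
    - emp_powR_ln b z - m * emp_powR b z by rewrite mE'; lra.
have E c : - emp_powR_ln c z - m * emp_powR c z =
    emp (fun p => - 1 * (p.2 `^ (- c) * ln p.2) + (- m) * p.2 `^ (- c)) z.
  by rewrite empD !empZ /emp_powR_ln /emp_powR; ring.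
rewrite !E -empZ.
apply: le_emp => p /zP[p0 _].
have := tilt_ge m (- ln p.2) ab; rewrite !mulrN.
rewrite !powR_gt0E// !mulNr => H; apply: le_trans (le_trans H _).
  by rewrite le_eqVlt; apply/orP; left; apply/eqP; ring.
by rewrite le_eqVlt; apply/orP; left; apply/eqP; ring.
Qed.

Lemma score_decreasing a b z : (0 < size z)%N -> admissible z -> 0 < a -> a < b ->
  score b z < score a z.
Proof.
move=> z0 zP a0 ab; have b0 := lt_trans a0 ab.
have : b^-1 < a^-1 by rewrite ltf_pV2.
have := emp_ratio_le z0 zP (ltW ab); rewrite /score; lra.
Qed.

Lemma continuous_emp (f : R -> R * R -> R) z a :
  {in z, forall p, {for a, continuous (f ^~ p)}} ->
  {for a, continuous (fun b => emp (f b) z)}.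
Proof.
move=> cf; apply: cvgM; first exact: cvg_cst.
elim: z cf => [|p z IH] cf.
  by under eq_fun do rewrite big_nil; rewrite big_nil; exact: cvg_cst.
under eq_fun do rewrite big_cons; rewrite big_cons; apply: cvgD.
  by apply: cf; rewrite mem_head.
by apply: IH => q qz; apply: cf; rewrite inE qz orbT.
Qed.

Lemma continuous_powR_expN y a : 0 < y -> {for a, continuous (fun b => y `^ (- b))}.
Proof.
move=> y0; have -> : (fun b => y `^ (- b)) = (fun b => expR (- b * ln y)).
  by apply/funext => b; rewrite powR_gt0E.
apply: (@continuous_comp _ _ _ (fun b => - b * ln y) (@expR R)).
  by apply: cvgM; [apply: cvgN; exact: cvg_id|exact: cvg_cst].
exact: continuous_expR.
Qed.

Lemma continuous_score z a : (0 < size z)%N -> admissible z -> 0 < a ->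
  {for a, continuous (score ^~ z)}.
Proof.
move=> z0 zP a0; apply: cvgB; last exact: cvg_cst.
apply: cvgD; first by apply: cvgV; [rewrite gt_eqF|exact: cvg_id].
apply: cvgM.
  apply: continuous_emp => p /zP[p0 _].
  by apply: cvgM; [exact: continuous_powR_expN|exact: cvg_cst].
apply: cvgV; first by rewrite gt_eqF// emp_powR_gt0.
by apply: continuous_emp => p /zP[p0 _]; exact: continuous_powR_expN.
Qed.

Lemma score_has_pos z : (0 < size z)%N -> admissible z ->
  exists2 a, 0 < a < 1 & 0 < score a z.
Proof.
move=> z0 zP; set c := emp_powR_ln 1 z / emp_powR 1 z - emp_ln z / 2.
have n0 := normr_ge0 c; have nc := ler_norm (- c); rewrite normrN in nc.
have a0 : 0 < (`|c| + 2)^-1 by rewrite invr_gt0; lra.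
have a1 : (`|c| + 2)^-1 < 1 by rewrite invf_lt1; lra.
exists (`|c| + 2)^-1; first by rewrite a0.
have := emp_ratio_le z0 zP (ltW a1); rewrite /score invrK.
move: nc n0; rewrite /c; lra.
Qed.

Lemma seq_min_snd z : (0 < size z)%N ->
  exists2 p, p \in z & {in z, forall q, p.2 <= q.2}.
Proof.
elim: z => // p [|q z] IH _.
  by exists p => [|r]; rewrite inE // => /eqP ->.
have [r rz rmin] := IH isT.
have [pr|rp] := leP p.2 r.2.
  exists p => [|t]; first by rewrite mem_head.
  by rewrite inE => /predU1P[->//|/rmin]; exact: le_trans.
exists r => [|t]; first by rewrite inE rz orbT.
by rewrite inE => /predU1P[->|/rmin//]; exact: ltW.
Qed.

(** As a grows, the weights y ^ (- a) concentrate on the smallest y, so that the score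
    tends to the log of this minimum minus the mean of all the log coordinates.  This
    difference is negative unless all coordinates are equal. *)
Lemma score_has_neg z : ~~ constant z -> admissible z ->
  exists2 b, 1 < b & score b z < 0.
Proof.
move=> zc zP; have z0 : (0 < size z)%N by case: z zc zP.
have [q qz qmin] := seq_min_snd z0; have [q0 _] := zP _ qz.
set m := ln q.2.
have lnm p : p \in z -> m <= ln p.2 /\ ln p.2 <= ln p.1.
  move=> pz; have [p0 p1] := zP _ pz; rewrite !ler_ln ?posrE// ?(lt_le_trans p0)//.
  by split=> //; exact: qmin.
have n0 : 0 < (size z)%:R :> R by rewrite ltr0n.
have gap : 0 < emp_ln z / 2 - m.
  pose f p := ln p.1 + ln p.2 + (- (2 * m)).
  have f0 : {in z, forall p, 0 <= f p}.
    by move=> p /lnm[m2 m1]; rewrite /f; lra.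
  have -> : emp_ln z / 2 - m = emp f z / 2.
    by rewrite /f !empD emp_cst// /emp_ln; field.
  rewrite divr_gt0// -(pmulr_rgt0 _ n0) ltNge; apply: contra zc => le0.
  apply: (@all_pred1_constant _ (q.2, q.2)); apply/allP => p pz.
  have := le_trans (emp_ge_term f0 pz) le0; have [m2 m1] := lnm _ pz => fp.
  have [p0 p1] := zP _ pz; have p10 := lt_le_trans p0 p1.
  have e2 : ln p.2 = m by move: fp; rewrite /f; lra.
  have e1 : ln p.1 = m by move: fp; rewrite /f; lra.
  case: p p0 p10 e1 e2 {pz m1 m2 fp p1} => x y /= y0 x0 e1 e2.
  have -> : x = q.2 by apply: ln_inj => //; rewrite posrE.
  have -> : y = q.2 by apply: ln_inj => //; rewrite posrE.
  by [].
pose n : R := (size z)%:R.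
have bound b : 0 < b -> score b z <= b^-1 * (1 + n) - (emp_ln z / 2 - m).
  move=> b0; have A0 := emp_powR_gt0 b z0 zP.
  suff : emp_powR_ln b z / emp_powR b z <= m + n / b by rewrite /score /n; lra.
  rewrite ler_pdivrMr// mulrDl -lerBlDl -mulNr -[X in _ + X <= _]empZ -empD.
  apply: (@le_trans _ _ (q.2 `^ (- b) / b)).
    rewrite -[leRHS](emp_cst _ z0); apply: le_emp => p pz.
    have [m2 _] := lnm _ pz; have [p0 _] := zP _ pz.
    (* u e ^ (- b u) <= 1 / b with u = ln p.2 - m *)
    rewrite ler_pdivlMr// (_ : _ * b = p.2 `^ (- b) * (b * (ln p.2 - m))); last ring.
    apply: (@le_trans _ _ (p.2 `^ (- b) * expR (b * (ln p.2 - m)))).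
      rewrite ler_wpM2l ?powR_ge0//; apply: le_trans (expR_ge1Dx _); lra.
    rewrite !powR_gt0E// -expRD ler_expR -/m; lra.
  rewrite mulrAC ler_pM2r ?invr_gt0// /n.
  exact: (emp_ge_term (f := fun p => p.2 `^ (- b)) (fun p _ => powR_ge0 _ _) qz).
set g := emp_ln z / 2 - m in gap bound.
have gn : 0 < (1 + n) / g by rewrite divr_gt0// /n; lra.
exists (1 + (1 + n) / g); first lra.
have b0 : 0 < 1 + (1 + n) / g by lra.
apply: le_lt_trans (bound _ b0) _.
rewrite subr_lt0 mulrC ltr_pdivrMr// mulrDr mulr1 mulrC divfK ?gt_eqF//; lra.
Qed.

End Score.

(** * The maximum likelihood estimator as the zero of the score *)

Section MLE.
Variable R : realType.
Implicit Types (z : seq (R * R)) (a b s : R) (p : R * R).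

Lemma score_has_zero z : ~~ constant z -> admissible z ->
  exists2 a, 0 < a & score a z = 0.
Proof.
move=> zc zP; have z0 : (0 < size z)%N by case: z zc zP.
have [a /andP[a0 a1] sa] := score_has_pos z0 zP.
have [b b1 sb] := score_has_neg zc zP.
have ab := lt_trans a1 b1.
have [||c /[!in_itv]/= /andP[ac cb] sc] := @IVT R (@score R ^~ z) a b 0 (ltW ab).
- apply/(continuous_within_itvP _ ab); split.
  + move=> x /[!in_itv]/= /andP[ax _]; apply: (continuous_score z0 zP); exact: lt_trans ax.
  + by apply: cvg_at_right_filter; exact: (continuous_score z0 zP).
  + by apply: cvg_at_left_filter; apply: (continuous_score z0 zP); exact: lt_trans ab.
- by rewrite ge_min le_max (ltW sa) (ltW sb) orbT.
- by exists c => //; exact: lt_le_trans ac.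
Qed.

Lemma loglikE a s z : (0 < size z)%N -> admissible z -> 0 < s ->
  loglik a s z = (size z)%:R * (2 * ln a + 2 * (a * ln s) - (a + 1) * emp_ln z
    - emp (fun p => expR (a * ln s - a * ln p.2)) z).
Proof.
move=> z0 zP s0; have n0 : (size z)%:R != 0 :> R by rewrite pnatr_eq0 -lt0n.
pose E p := expR (a * ln s - a * ln p.2).
rewrite /loglik.
have -> : \sum_(p <- z) ((a + 1) * ln (p.1 * p.2) + s `^ a * p.2 `^ (- a)) =
    (size z)%:R * ((a + 1) * emp_ln z + emp E z).
  rewrite /emp_ln -empD -empZ -empD /emp mulVKf//.
  apply: eq_big_seq => p /zP[p0 p1]; have p10 := lt_le_trans p0 p1.
  rewrite lnM ?posrE// /E; congr (_ + _).
  by rewrite !powR_gt0E// -expRD; congr expR; ring.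
by rewrite -/E; ring.
Qed.

Lemma ln_lt_sub1 (t : R) : 0 < t -> t != 1 -> ln t < t - 1.
Proof.
move=> t0 t1; have l0 : ln t != 0 by rewrite ln_eq0.
have := expR_gt1Dx l0; rewrite lnK ?posrE//; lra.
Qed.

(** In the coordinates (a, a ln s) the log-likelihood is concave, so the supporting
    hyperplane at a critical point, which is horizontal, lies above its graph. *)
Lemma loglik_lt z a s a' s' : (0 < size z)%N -> admissible z ->
  0 < a -> 0 < s -> 0 < a' -> 0 < s' ->
  score a z = 0 -> s `^ a * emp_powR a z = 2 -> (a', s') <> (a, s) ->
  loglik a' s' z < loglik a s z.
Proof.
move=> z0 zP a0 s0 a'0 s'0 sc sA ne.
have n0 : 0 < (size z)%:R :> R by rewrite ltr0n.
rewrite !loglikE// ltr_pM2l//.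
have A0 := emp_powR_gt0 a z0 zP.
pose u p := expR (a * ln s - a * ln p.2).
set d := a' * ln s' - a * ln s.
have uE p : p \in z -> u p = s `^ a * p.2 `^ (- a).
  by move=> /zP[p0 _]; rewrite /u !powR_gt0E// -expRD; congr expR; ring.
have Eu : emp u z = 2.
  by rewrite (eq_emp uE) empZ.
have Eul : emp (fun p => u p * ln p.2) z = 2 * (emp_powR_ln a z / emp_powR a z).
  rewrite (eq_emp (g := fun p => s `^ a * (p.2 `^ (- a) * ln p.2))).
    by rewrite empZ -[in RHS]sA -/(emp_powR_ln a z); field; rewrite gt_eqF.
  by move=> p pz; rewrite /= uE//; ring.
have crit : 2 * (emp_powR_ln a z / emp_powR a z) = emp_ln z - 2 * a^-1.
  by move: sc; rewrite /score; lra.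
have vE p : expR (a' * ln s' - a' * ln p.2) = u p * expR (d - (a' - a) * ln p.2).
  by rewrite /u -expRD; congr expR; rewrite /d; ring.
rewrite -/u Eu.
have [e|ne_a] := eqVneq a' a.
  rewrite {}e in ne d vE *.
  have d0 : d != 0.
    apply/eqP => d0; apply: ne; congr (_, _); apply: ln_inj; rewrite ?posrE//.
    apply: (mulfI (lt0r_neq0 a0)); move: d0; rewrite /d; lra.
  have -> : emp (fun p => expR (a * ln s' - a * ln p.2)) z = expR d * 2.
    rewrite -Eu -empZ; apply: eq_emp => p _ /=.
    by rewrite vE subrr mul0r subr0 mulrC.
  have := expR_gt1Dx d0; rewrite /d; lra.
have lo : 2 * (1 + d) - (a' - a) * (emp_ln z - 2 * a^-1) <=
    emp (fun p => expR (a' * ln s' - a' * ln p.2)) z.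
  rewrite -crit -Eul -Eu (_ : _ - _ = emp (fun p => (1 + d) * u p +
     (- (a' - a)) * (u p * ln p.2)) z); last by rewrite empD !empZ; ring.
  apply: le_emp => p pz /=; rewrite vE.
  apply: (@le_trans _ _ (u p * (1 + (d - (a' - a) * ln p.2)))).
    by rewrite le_eqVlt; apply/orP; left; apply/eqP; ring.
  by rewrite ler_wpM2l ?expR_ge0// expR_ge1Dx.
have nea : a' / a != 1.
  by apply: contra_neq ne_a => e; rewrite -[a'](divfK (lt0r_neq0 a0)) e mul1r.
have := ln_lt_sub1 (divr_gt0 a'0 a0) nea; rewrite ln_div ?posrE// => lnlt.
have aV : (a' - a) * a^-1 = a' / a - 1 by field; rewrite gt_eqF.
move: lo; rewrite /d mulrBr [_ * (2 * _)]mulrCA aV; lra.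
Qed.

Lemma theta_hatP z : ~~ constant z -> admissible z ->
  [/\ 0 < (theta_hat z).1, score (theta_hat z).1 z = 0 &
      (theta_hat z).2 =
        (2 / emp_powR (theta_hat z).1 z) `^ ((theta_hat z).1)^-1].
Proof.
move=> zc zP; have z0 : (0 < size z)%N by case: z zc zP.
have [a a0 sa] := score_has_zero zc zP.
have A0 := emp_powR_gt0 a z0 zP.
pose s := (2 / emp_powR a z) `^ a^-1.
have s0 : 0 < s by rewrite powR_gt0// divr_gt0.
have sA : s `^ a * emp_powR a z = 2.
  rewrite /s -powRrM mulVf ?gt_eqF// powRr1 ?divfK ?gt_eqF//.
  by rewrite divr_ge0// ltW.
suff -> : theta_hat z = (a, s) by [].
have max_as : is_maximizer z (a, s).
  split=> // a' s' a'0 s'0 /=.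
  have [[-> ->]//|/eqP ne] := eqVneq (a', s') (a, s).
  exact/ltW/loglik_lt.
rewrite /theta_hat; case: xgetP => [[a' s'] _ [/= a'0 s'0 mx]|/(_ (a, s))//].
apply/eqP; apply: contraT => /eqP ne.
by have := mx _ _ a0 s0; rewrite leNgt (loglik_lt z0 zP a0 s0 a'0 s'0 sa sA ne).
Qed.

Definition rescale s z := [seq (p.1 / s, p.2 / s) | p <- z].

Lemma admissible_rescale s z : 0 < s -> admissible z -> admissible (rescale s z).
Proof.
move=> s0 zP _ /mapP[p /zP[p0 p1] ->] /=.
by rewrite divr_gt0// ler_pM2r ?invr_gt0.
Qed.

Lemma emp_powR_rescale a s z : 0 < s -> admissible z ->
  emp_powR a (rescale s z) = s `^ a * emp_powR a z.
Proof.
move=> s0 zP; rewrite /emp_powR /rescale emp_map -empZ /emp; congr (_ * _).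
apply: eq_big_seq => p /zP[p0 _] /=.
by rewrite !powR_gt0E ?divr_gt0// ln_div ?posrE// -expRD; congr expR; ring.
Qed.

Lemma emp_powR_ln_rescale a s z : 0 < s -> admissible z ->
  emp_powR_ln a (rescale s z) = s `^ a * (emp_powR_ln a z - ln s * emp_powR a z).
Proof.
move=> s0 zP; rewrite /emp_powR_ln /rescale emp_map.
rewrite -mulNr -[X in _ + X]empZ -empD -empZ /emp; congr (_ * _).
apply: eq_big_seq => p /zP[p0 _] /=.
rewrite !powR_gt0E ?divr_gt0// ln_div ?posrE//.
have -> : - a * (ln p.2 - ln s) = a * ln s + - a * ln p.2 by ring.
by rewrite expRD; ring.
Qed.

Lemma emp_ln_rescale s z : (0 < size z)%N -> 0 < s -> admissible z ->
  emp_ln (rescale s z) = emp_ln z - 2 * ln s.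
Proof.
move=> z0 s0 zP; rewrite /emp_ln /rescale !emp_map -!/(emp _ z).
rewrite -[2 * ln s](emp_cst _ z0) -mulN1r -empZ -!empD.
apply: eq_emp => p /zP[p0 p1] /=; have p10 := lt_le_trans p0 p1.
by rewrite !ln_div ?posrE//; ring.
Qed.

Lemma score_rescale a s z : (0 < size z)%N -> 0 < s -> admissible z ->
  score a (rescale s z) = score a z.
Proof.
move=> z0 s0 zP; have A0 := emp_powR_gt0 a z0 zP.
rewrite /score emp_powR_rescale// emp_powR_ln_rescale// emp_ln_rescale//.
have := powR_gt0 a s0; move: (s `^ a) => sa sa0.
by move: (a^-1) => ai; field; rewrite !gt_eqF.
Qed.

(** The estimators are scale equivariant, so that they can be studied through the
    rescaled sample, for which limits are available. *)
Lemma theta_hat_rescale s z : 0 < s -> ~~ constant z -> admissible z ->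
  let a := (theta_hat z).1 in
  [/\ 0 < a, score a (rescale s z) = 0 &
      (theta_hat z).2 / s = (2 / emp_powR a (rescale s z)) `^ a^-1].
Proof.
move=> s0 zc zP a; have z0 : (0 < size z)%N by case: z zc zP @a.
have [a0 sa ->] := theta_hatP zc zP; rewrite -/a in a0 sa *.
have A0 := emp_powR_gt0 a z0 zP.
split=> //; first by rewrite score_rescale.
have A2 : 0 <= 2 / emp_powR a z by rewrite divr_ge0// ltW.
have sV : 0 <= (s `^ a)^-1 by rewrite invr_ge0 powR_ge0.
rewrite emp_powR_rescale// (_ : 2 / (s `^ a * emp_powR a z) = (s `^ a)^-1 * (2 / emp_powR a z)); last first.
  by rewrite invfM mulrCA.
rewrite (powRM _ sV A2).
by rewrite -powRN -powRrM mulNr mulfV ?gt_eqF// powR_inv1 ?(ltW s0)// mulrC.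
Qed.

(** Since the score decreases, the position of its zero is read off its sign at a fixed
    point. *)
Lemma theta_hat_gt s b z : 0 < s -> ~~ constant z -> admissible z -> 0 < b ->
  (b < (theta_hat z).1) = (0 < score b (rescale s z)).
Proof.
move=> s0 zc zP b0; have z0 : (0 < size z)%N by case: z zc zP.
rewrite score_rescale//; have [a0 sa _] := theta_hatP zc zP.
move: (theta_hat z).1 a0 sa => a a0 sa.
apply/idP/idP => [ba|sb]; first by rewrite -sa; exact: score_decreasing.
rewrite ltNge; apply/negP; rewrite le_eqVlt => /predU1P[ab|ab].
  by move: sb; rewrite -ab sa ltxx.
by have := score_decreasing z0 zP a0 ab; rewrite sa; lra.
Qed.

Lemma theta_hat_lt s b z : 0 < s -> ~~ constant z -> admissible z -> 0 < b ->
  ((theta_hat z).1 < b) = (score b (rescale s z) < 0).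
Proof.
move=> s0 zc zP b0; have z0 : (0 < size z)%N by case: z zc zP.
rewrite score_rescale//; have [a0 sa _] := theta_hatP zc zP.
move: (theta_hat z).1 a0 sa => a a0 sa.
apply/idP/idP => [ba|sb]; first by rewrite -sa; exact: score_decreasing.
rewrite ltNge; apply/negP; rewrite le_eqVlt => /predU1P[ab|ab].
  by move: sb; rewrite ab sa ltxx.
by have := score_decreasing z0 zP b0 ab; rewrite sa; lra.
Qed.

End MLE.

(** * Convergence in probability as convergence along a filter *)

Section ProbFilter.
Context (R : realType) (d : nat -> measure_display)
  (Om : forall n, measurableType (d n)) (P : forall n, probability (Om n) R).

(** A property of the points of the disjoint union of the sample spaces is eventual when
    it holds in row n on a measurable event of probability tending to 1. *)
Definition prob_filter : set_system {n : nat & Om n} := [set A |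
  exists B : forall n, set (Om n),
    [/\ forall n, measurable (B n),
        forall n w, B n w -> A (existT _ n w) &
        P n (~` B n) @[n --> \oo] --> 0%E]].

Global Instance prob_filter_filter : Filter prob_filter.
Proof.
split.
- exists (fun n => setT); split => //.
  by under eq_fun do rewrite setCT measure0; exact: cvg_cst.
- move=> A A' [B [mB BA PB]] [B' [mB' BA' PB']].
  exists (fun n => B n `&` B' n); split.
  + by move=> n; exact: measurableI.
  + by move=> n w [/BA ? /BA' ?].
  + apply: (@squeeze_cvge _ _ _ _ (fun=> 0%E) _ (fun n => P n (~` B n) + P n (~` B' n))%E).
    * apply: nearW => n; rewrite measure_ge0/= setCI.
      exact: measureU2 (measurableC (mB n)) (measurableC (mB' n)).
    * exact: cvg_cst.
    * by rewrite -[X in _ --> X](adde0 0%E); apply: cvgeD.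
- move=> A A' AA' [B [mB BA PB]]; exists B; split => // n w /BA; exact: AA'.
Qed.

Lemma open_measurable_fun (T : topologicalType) n (X : Om n -> T) (f : T -> R) :
  (forall U : set T, open U -> measurable (X @^-1` U)) -> continuous f ->
  measurable_fun setT (f \o X).
Proof.
move=> mX /continuousP cf; apply: (measurability _ (RGenOpens.measurableE R)).
move=> _ [_ [a [b ->] <-]]; rewrite setTI.
by rewrite comp_preimage; apply: mX; apply: cf; exact: interval_open.
Qed.


(** Markov's inequality for the bounded continuous function min (1, |c - x| / e). *)
Lemma weak_cvg_cst_prob (X : forall n, Om n -> R) (c : R) :
  weak_cvg_cst P X c -> X (projT1 t) (projT2 t) @[t --> prob_filter] --> c.
Proof.
move=> [mX EX]; apply/cvgrPdist_lt => e e0.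
pose f (x : R) : R := Order.min 1 (`|c - x| / e).
have cf : continuous f.
  move=> x; apply: (@continuous_min _ _ (fun=> 1) (fun x => `|c - x| / e)).
    exact: cvg_cst.
  apply: cvgM; last exact: cvg_cst.
  by apply: cvg_norm; apply: cvgB; [exact: cvg_cst|exact: cvg_id].
have f0 x : 0 <= f x by rewrite /f le_min ler01 divr_ge0// ltW.
have f1 x : f x <= 1 by rewrite /f ge_min lexx.
have bf : bounded_fun f.
  exists 1; split => // M M1 x _ /=.
  by rewrite ger0_norm; [exact: le_trans (f1 x) (ltW M1)|exact: f0].
have fc : f c = 0 by rewrite /f subrr normr0 mul0r min_r.
have := EX f cf bf; rewrite fc => Ef.
pose B n := X n @^-1` [set x | `|c - x| < e].
have mB n : measurable (B n).
  apply: mX; rewrite (_ : [set x | _] = ball c e); first exact: ball_open.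
  by rewrite -ball_normE.
exists B; split => //.
apply: (squeeze_cvge _ (cvg_cst _) Ef).
apply: nearW => n; rewrite measure_ge0/= unlock.
have mCB : measurable (~` B n) by exact: measurableC.
rewrite -[~` B n]setIT -(integral_indic (P n) measurableT mCB).
apply: ge0_le_integral => //.
- exact/measurable_EFinP/measurable_indic.
- exact/measurable_EFinP/(open_measurable_fun (mX n) cf).
- move=> w _; rewrite lee_fin indicE; case: (boolP (w \in ~` B n)); last by rewrite f0.
  rewrite inE /= => /negP; rewrite -leNgt => ew.
  by rewrite /f le_min lexx ler_pdivlMr// mul1r.
Qed.

(** Outside an event of vanishing probability f (X n) is close to f c, and on that event
    the difference is bounded. *)
Lemma prob_weak_cvg_cst (T : topologicalType) (X : forall n, Om n -> T) (c : T) :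
  (forall n (U : set T), open U -> measurable (X n @^-1` U)) ->
  X (projT1 t) (projT2 t) @[t --> prob_filter] --> c ->
  weak_cvg_cst P X c.
Proof.
move=> mX cX; split => // f cf [M0 [_ /(_ (`|M0| + 1))]].
rewrite (le_lt_trans (ler_norm _)) ?ltrDl// => /(_ erefl) Mf.
set M := `|M0| + 1 in Mf.
have {}Mf x : `|f x| <= M by exact: Mf.
have M_ge0 : 0 <= M by rewrite /M addr_ge0.
have mY n := open_measurable_fun (mX n) cf.
have mYi n : (P n).-integrable setT (EFin \o (f \o X n)).
  apply: measurable_bounded_integrable => //.
    by apply: le_lt_trans (probability_le1 _ _) (ltry _).
  exists M; split; first exact: num_real.
  by move=> M' MM' w _ /=; exact: le_trans (Mf _) (ltW MM').
have EE n : 'E_(P n)[f \o X n]%E = (\int[P n]_w f (X n w))%:E.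
  by rewrite unlock /Rintegral fineK//; apply: integrable_fin_num => //; exact: mYi.
rewrite (funext EE); apply: cvg_EFin; first exact: nearW.
rewrite /=; apply/cvgrPdist_le => e e0.
have e2 : 0 < e / 2 by rewrite divr_gt0.
have /cvgrPdist_lt /(_ _ e2) [B [mB BX PB]] :
  f (X (projT1 t) (projT2 t)) @[t --> prob_filter] --> f c.
  exact: (continuous_cvg _ (cf c) cX).
have : fine (P n (~` B n)) @[n --> \oo] --> 0 by exact: fine_cvg PB.
have eM : 0 < e / (2 * (2 * M + 1)) by rewrite divr_gt0// mulr_gt0//; lra.
move/cvgrPdist_lt => /(_ _ eM); apply: filterS => n; rewrite sub0r normrN => Pn.
have mCB : measurable (~` B n) by exact: measurableC.
have intc : (P n).-integrable setT (EFin \o (fun=> f c)).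
  exact: finite_measure_integrable_cst.
have Pcst r : \int[P n]_w r = r.
  transitivity (r * fine (P n setT)); last by rewrite probability_setT mulr1.
  by rewrite Rintegral_cst.
rewrite -[f c]Pcst.
rewrite -(RintegralB measurableT intc (mYi n)).
have iD : (P n).-integrable setT (EFin \o (fun w => f c - f (X n w))).
  exact: (integrable_EFinB measurableT intc (mYi n)).
apply: le_trans (le_normr_Rintegral _ iD) _ => //.
have i1 : (P n).-integrable setT (EFin \o (\1_(~` B n) : _ -> R)).
  exact: integrable_indic.
have i2 : (P n).-integrable setT (EFin \o (fun=> e / 2)).
  exact: finite_measure_integrable_cst.
have i3 := integrable_EFinZ measurableT (2 * M) i1.
apply: (@le_trans _ _ (\int[P n]_w (e / 2 + 2 * M * \1_(~` B n) w))).
  apply: le_Rintegral => //.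
  - exact: integrable_norm.
  - exact: integrable_EFinD.
  move=> w _; rewrite indicE; case: (boolP (w \in ~` B n)) => wB.
    rewrite mulr1; apply: le_trans (ler_normB _ _) _.
    by have := Mf c; have := Mf (X n w); lra.
  rewrite mulr0 addr0; apply: ltW; apply: (BX n w).
  by move: wB; rewrite notin_setE /= => /contrapT.
rewrite RintegralD// Pcst RintegralZl//.
have -> : \int[P n]_w \1_(~` B n) w = fine (P n (~` B n)).
  by rewrite /Rintegral integral_indic// setIT.
have {Pn} : fine (P n (~` B n)) < e / (2 * (2 * M + 1)).
  by rewrite (le_lt_trans (ler_norm _)).
rewrite ltr_pdivlMr; last by rewrite mulr_gt0//; lra.
have : 0 <= fine (P n (~` B n)) by exact: fine_ge0.
move: (fine _) => q; nra.
Qed.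

End ProbFilter.

(** * Measurability of the estimators *)

Section RealMeasurability.
Context (R : realType) d (T : measurableType d).
Implicit Types f g : T -> R.

Lemma measurable_fun_gt f :
  (forall b, measurable [set w | b < f w]) -> measurable_fun [set: T] f.
Proof.
move=> mf; apply: (measurability _ (RGenOInfty.measurableE R)).
move=> _ [_ [b ->] <-]; rewrite setTI.
rewrite (_ : _ @^-1` _ = [set w | b < f w]); first exact: mf.
by apply/seteqP; split => w /=; rewrite in_itv /= andbT.
Qed.

Lemma measurable_bool_set (b : T -> bool) :
  measurable_fun [set: T] b -> measurable [set w | b w].
Proof.
move=> mb; rewrite (_ : [set w | _] = setT `&` b @^-1` [set true]); first exact: mb.
by apply/seteqP; split => w /=; [|case].
Qed.

Lemma measurable_lt_set f g : measurable_fun [set: T] f -> measurable_fun [set: T] g ->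
  measurable [set w | f w < g w].
Proof.
by move=> mf mg; apply: measurable_bool_set; exact: measurable_fun_ltr.
Qed.

(** The plane has a countable base of rational boxes. *)
Lemma measurable_open_pair f g (U : set (R * R)) :
  measurable_fun [set: T] f -> measurable_fun [set: T] g -> open U ->
  measurable [set w | U (f w, g w)].
Proof.
move=> mf mg oU.
pose box (q : rat * rat * rat * rat) : set (R * R) :=
  [set p | (ratr q.1.1.1 < p.1 /\ p.1 < ratr q.1.1.2) /\
           (ratr q.1.2 < p.2 /\ p.2 < ratr q.2)].
pose F q : set T := if `[< box q `<=` U >] then [set w | box q (f w, g w)] else set0.
rewrite (_ : [set w | _] = \bigcup_q F q).
  apply: countable_bigcupT_measurable; first exact: countableP.
  move=> q; rewrite /F; case: asboolP => // _.
  have mc (c : R) : measurable_fun [set: T] (fun=> c) by exact: measurable_cst.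
  exact: (measurableI _ _
    (measurableI _ _ (measurable_lt_set (mc _) mf) (measurable_lt_set mf (mc _)))
    (measurableI _ _ (measurable_lt_set (mc _) mg) (measurable_lt_set mg (mc _)))).
apply/seteqP; split => w /=; last first.
  by move=> [q _]; rewrite /F; case: asboolP => // qU; exact: qU.
move=> Uw; have := oU; rewrite openE => /(_ _ Uw) /nbhs_ballP[e /= e0 eU].
have itv (x : R) : exists q : rat * rat, (x - e < ratr q.1 < x) && (x < ratr q.2 < x + e).
  have /rat_in_itvoo[q1] : x - e < x by rewrite ltrBlDr ltrDl.
  have /rat_in_itvoo[q2] : x < x + e by rewrite ltrDl.
  by rewrite !in_itv /= => h2 h1; exists (q1, q2); rewrite /= h1 h2.
have [q /andP[/andP[q1 q2] /andP[q3 q4]]] := itv (f w).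
have [r /andP[/andP[r1 r2] /andP[r3 r4]]] := itv (g w).
exists (q, r.1, r.2) => //; rewrite /F; case: asboolP => [_|[]]; first by rewrite /box /=.
move=> [x y] [/= [x1 x2] [y1 y2]]; apply: eU; split => /=; rewrite -ball_normE /= ltr_distlC.
  by apply/andP; split; lra.
by apply/andP; split; lra.
Qed.

End RealMeasurability.

Section EstimatorMeasurability.
Context (R : realType) d (T : measurableType d).

Lemma measurable_funV_gt0 (f : T -> R) : (forall w, 0 < f w) ->
  measurable_fun [set: T] f -> measurable_fun [set: T] (fun w => (f w)^-1).
Proof.
move=> f0 mf; rewrite (_ : (fun w => _) = (fun w => f w `^ (- 1))).
  exact: measurableT_comp (measurable_powR _) mf.
by apply/funext => w; rewrite powR_inv1// ltW.
Qed.

Lemma measurable_powR_gt0 (f g : T -> R) : (forall w, 0 < f w) ->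
  measurable_fun [set: T] f -> measurable_fun [set: T] g ->
  measurable_fun [set: T] (fun w => f w `^ g w).
Proof.
move=> f0 mf mg; rewrite (_ : (fun w => _) = (fun w => expR (g w * ln (f w)))).
  apply: measurableT_comp; first exact: measurable_expR.
  by apply: measurable_funM => //; exact: measurableT_comp (@measurable_ln R) mf.
by apply/funext => w; rewrite powR_gt0E.
Qed.

Variable rho : T -> R.
Hypothesis rho01 : forall w, 0 <= rho w <= 1.
Hypothesis mrho : measurable_fun [set: T] rho.

Lemma measurable_varpi : measurable_fun [set: T] (fun w => varpi (rho w)).
Proof.
apply: measurable_fun_gt => b.
have [b0|b0] := leP b 0.
  rewrite (_ : [set w | _] = setT)//; apply/seteqP; split => // w _ /=.
  by apply: le_lt_trans b0 _; exact: varpi_gt0.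
have b1 : -1 < b by lra.
pose f w := Upsilon_ln (rho w) b.
pose g w := (b^-1 + rho w / 2 - euler_mascheroni R) * Upsilon (rho w) b.
rewrite (_ : [set w | _] = [set w | f w < g w]).
  have mc (c : R) : measurable_fun [set: T] (fun=> c) by exact: measurable_cst.
  have m1 : measurable_fun [set: T] (fun w => 1 - rho w) by exact: measurable_funB.
  apply: measurable_lt_set.
    by apply: measurable_funD; apply: measurable_funM.
  apply: measurable_funM.
    by apply: measurable_funB => //; apply: measurable_funD => //; apply: measurable_funM.
  by apply: measurable_funD; apply: measurable_funM.
suff E w : (b < varpi (rho w)) = (f w < g w).
  by apply/seteqP; split => w /=; rewrite E.
have u0 := Upsilon_gt0 (rho01 w) b1.
rewrite -[RHS]subr_gt0 varpi_gt// -[LHS](pmulr_lgt0 _ u0) Pi_funE//.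
rewrite [X in (0 < X) = _](_ : _ = g w - f w)//.
by rewrite /f /g; field; rewrite !gt_eqF.
Qed.

Lemma measurable_Upsilon (f : T -> R) : (forall w, 0 < f w) ->
  measurable_fun [set: T] f -> measurable_fun [set: T] (fun w => Upsilon (rho w) (f w)).
Proof.
move=> f0 mf.
have mG c : 0 < c -> measurable_fun [set: T] (fun w => Gamma_fun (f w + c)).
  move=> c0; apply: (@measurable_comp _ _ _ _ _ _ [set` `]0, +oo[ : interval R]
    (@Gamma_fun R) setT (fun w => f w + c)).
  - exact: measurable_itv.
  - by move=> _ [w _ <-]; rewrite /= in_itv /= andbT addr_gt0.
  - apply: continuous_gt0_measurable => x x0.
    exact: is_derive1_continuous (is_derive_Gamma_fun x0).
  - by apply: measurable_funD.
apply: measurable_funD; apply: measurable_funM => //; try exact: mG.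
by apply: measurable_funB.
Qed.

End EstimatorMeasurability.

Section SampleMeasurability.
Context (R : realType) d (T : measurableType d) (k : nat).
Variable Z : 'I_k -> T -> R * R.
Hypothesis k_ge2 : (2 <= k)%N.
Hypothesis mZ : forall i, measurable_fun [set: T] (Z i).
Hypothesis Z_dom : forall i w, 0 < (Z i w).2 /\ (Z i w).2 <= (Z i w).1.
Variable s : R.
Hypothesis s0 : 0 < s.

Lemma size_sample w : size (sample Z w) = k.
Proof. by rewrite size_map size_enum_ord. Qed.

Lemma size_sample_gt0 w : (0 < size (sample Z w))%N.
Proof. by rewrite size_sample; apply: leq_trans k_ge2. Qed.

Lemma admissible_sample w : admissible (sample Z w).
Proof. by move=> _ /mapP[i _ ->]; exact: Z_dom. Qed.

Lemma emp_sample (f : R * R -> R) w : emp f (rescale s (sample Z w)) =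
  k%:R^-1 * \sum_(i < k) f ((Z i w).1 / s, (Z i w).2 / s).
Proof. by rewrite /rescale emp_map size_sample big_map big_enum. Qed.

Let m1 i : measurable_fun [set: T] (fun w => (Z i w).1 / s).
Proof.
apply: measurable_funM; last exact: measurable_cst.
exact: measurableT_comp measurable_fst (mZ i).
Qed.

Let m2 i : measurable_fun [set: T] (fun w => (Z i w).2 / s).
Proof.
apply: measurable_funM; last exact: measurable_cst.
exact: measurableT_comp measurable_snd (mZ i).
Qed.

Let z2_gt0 i w : 0 < (Z i w).2 / s.
Proof. by have [z0 _] := Z_dom i w; rewrite divr_gt0. Qed.

Let measurable_emp (h : 'I_k -> T -> R) (f : R * R -> T -> R) :
  (forall i w, f ((Z i w).1 / s, (Z i w).2 / s) w = h i w) ->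
  (forall i, measurable_fun [set: T] (h i)) ->
  measurable_fun [set: T] (fun w => emp (f ^~ w) (rescale s (sample Z w))).
Proof.
move=> fh mh; rewrite (_ : (fun w => _) = (fun w => k%:R^-1 * \sum_(i < k) h i w)).
  apply: measurable_funM; first exact: measurable_cst.
  exact: measurable_sum.
by apply/funext => w; rewrite emp_sample; congr (_ * _); apply: eq_bigr.
Qed.

Lemma measurable_emp_powR (a : T -> R) : measurable_fun [set: T] a ->
  measurable_fun [set: T] (fun w => emp_powR (a w) (rescale s (sample Z w))).
Proof.
move=> ma; apply: (measurable_emp (h := fun i w => ((Z i w).2 / s) `^ (- a w))
  (f := fun p w => p.2 `^ (- a w))) => // i.
apply: measurable_powR_gt0; [exact: z2_gt0|exact: m2|exact: measurable_funN].
Qed.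

Lemma measurable_emp_powR_ln b :
  measurable_fun [set: T] (fun w => emp_powR_ln b (rescale s (sample Z w))).
Proof.
apply: (measurable_emp (h := fun i w => ((Z i w).2 / s) `^ (- b) * ln ((Z i w).2 / s))
  (f := fun p w => p.2 `^ (- b) * ln p.2)) => // i.
apply: measurable_funM; first exact: measurableT_comp (measurable_powR _) (m2 i).
exact: measurableT_comp (@measurable_ln R) (m2 i).
Qed.

Lemma measurable_emp_ln :
  measurable_fun [set: T] (fun w => emp_ln (rescale s (sample Z w))).
Proof.
apply: measurable_funD.
  apply: (measurable_emp (h := fun i w => ln ((Z i w).1 / s))
    (f := fun p w => ln p.1)) => // i.
  exact: measurableT_comp (@measurable_ln R) (m1 i).
apply: (measurable_emp (h := fun i w => ln ((Z i w).2 / s))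
  (f := fun p w => ln p.2)) => // i.
exact: measurableT_comp (@measurable_ln R) (m2 i).
Qed.

Lemma measurable_constant_sample : measurable [set w | constant (sample Z w)].
Proof.
pose i0 : 'I_k := Ordinal (ltnW k_ge2).
pose D i := [set w | (Z i w).1 / s == (Z i0 w).1 / s] `&`
  [set w | (Z i w).2 / s == (Z i0 w).2 / s].
rewrite (_ : [set w | _] = \bigcap_(i in [set: 'I_k]) D i).
  apply: fin_bigcap_measurable; first exact: finite_finset.
  move=> i _; apply: measurableI.
    by apply: measurable_bool_set; exact: measurable_fun_eqr.
  by apply: measurable_bool_set; exact: measurable_fun_eqr.
have sV : s^-1 != 0 by rewrite invr_eq0 gt_eqF.
apply/seteqP; split => w /=.
  move=> /(constantP (0, 0))[x sx] i _.
  have Zx j : Z j w = x.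
    have : Z j w \in sample Z w by apply: map_f; rewrite mem_enum.
    by rewrite sx mem_nseq => /andP[_ /eqP].
  by rewrite /D /= !Zx.
move=> DZ; apply: (@all_pred1_constant _ (Z i0 w)); apply/allP => _ /mapP[i _ ->] /=.
have [/= /eqP e1 /eqP e2] := DZ i I.
by rewrite [Z i w]surjective_pairing [Z i0 w]surjective_pairing (mulIf sV e1) (mulIf sV e2).
Qed.

End SampleMeasurability.

(** * Interpolation of empirical moments *)

Section Interpolation.
Variable R : realType.
Implicit Types (u l a h y : R) (z : seq (R * R)).

(** Convexity, from the tangent at l u evaluated at u and at 0. *)
Lemma expR_chord u l : 0 <= l <= 1 -> expR (l * u) <= 1 - l + l * expR u.
Proof.
move=> /andP[l0 l1]; have e0 := expR_ge0 (l * u).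
have h1 : expR (l * u) * (1 + (1 - l) * u) <= expR u.
  rewrite [leRHS](_ : _ = expR (l * u) * expR ((1 - l) * u)).
    by rewrite ler_wpM2l// expR_ge1Dx.
  by rewrite -expRD; congr expR; ring.
have h2 : expR (l * u) * (1 - l * u) <= 1.
  rewrite [leRHS](_ : _ = expR (l * u) * expR (- (l * u))).
    by rewrite ler_wpM2l// expR_ge1Dx.
  by rewrite expRN mulfV// gt_eqF// expR_gt0.
have l1' : 0 <= 1 - l by lra.
have := ler_wpM2l l0 h1; have := ler_wpM2l l1' h2; lra.
Qed.

Lemma powR_chord a s h y : 0 < h -> `|s| <= h -> 0 < y ->
  y `^ (- (a + s)) <= y `^ (- a) + `|s| / h * (y `^ (- (a + h)) + y `^ (- (a - h))).
Proof.
move=> h0 sh y0; set l := `|s| / h.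
have l01 : 0 <= l <= 1.
  by rewrite /l divr_ge0 ?(ltW h0)//= ler_pdivrMr// mul1r.
have lh : l * h = `|s| by rewrite /l divfK// gt_eqF.
have Y b c : y `^ (- (b + c)) = y `^ (- b) * expR (- c * ln y).
  by rewrite !powR_gt0E// -expRD; congr expR; ring.
rewrite !Y; set p := y `^ (- a); have p0 : 0 <= p by exact: powR_ge0.
have [s0|s0] := leP 0 s.
  have -> : - s * ln y = l * (- h * ln y) by rewrite mulrA mulrN lh ger0_norm.
  have := ler_wpM2l p0 (expR_chord (- h * ln y) l01).
  case/andP: l01 => l0 _.
  have := mulr_ge0 l0 (mulr_ge0 p0 (expR_ge0 (- - h * ln y))).
  have := mulr_ge0 l0 p0; lra.
have -> : - s * ln y = l * (- - h * ln y) by rewrite mulrA opprK lh ltr0_norm.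
have := ler_wpM2l p0 (expR_chord (- - h * ln y) l01).
case/andP: l01 => l0 _.
have := mulr_ge0 l0 (mulr_ge0 p0 (expR_ge0 (- h * ln y))).
have := mulr_ge0 l0 p0; lra.
Qed.

(** Each y ^ (- b) is convex in b, hence lies above its tangent at a, and below its
    chords from a to a - h and a + h. *)
Lemma emp_powR_bounds z a b h : admissible z -> 0 < h -> `|b - a| <= h ->
  emp_powR a z - (b - a) * emp_powR_ln a z <= emp_powR b z <=
  emp_powR a z + `|b - a| / h * (emp_powR (a + h) z + emp_powR (a - h) z).
Proof.
move=> zP h0 bh; apply/andP; split.
  rewrite -mulNr -empZ -empD; apply: le_emp => p /zP[p0 _].
  have -> : p.2 `^ (- b) = p.2 `^ (- a) * expR (- (b - a) * ln p.2).
    by rewrite !powR_gt0E// -expRD; congr expR; ring.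
  apply: (@le_trans _ _ (p.2 `^ (- a) * (1 + - (b - a) * ln p.2))).
    by rewrite le_eqVlt; apply/orP; left; apply/eqP; ring.
  by rewrite ler_wpM2l ?powR_ge0// expR_ge1Dx.
rewrite -empD -empZ -empD; apply: le_emp => p /zP[p0 _].
by have := powR_chord a h0 bh p0; rewrite subrKC.
Qed.

End Interpolation.

(** * Consistency of the bias-corrected estimators *)

Lemma cvg_EFin_pair (R : realType) (T : Type) (F : set_system T) (FF : Filter F)
  (f g : T -> R) (a b : R) : f @ F --> a -> g @ F --> b ->
  ((f t)%:E, g t) @[t --> F] --> (a%:E, b).
Proof.
move=> fa gb.
apply: (@cvg_pair _ _ _ F (nbhs a%:E) (nbhs b) _ _ _ (fun t => (f t)%:E) g) => //.
by apply: cvg_EFin => //; exact: nearW.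
Qed.

Section Consistency.
Context (R : realType) (d : nat -> measure_display)
  (Om : forall n, measurableType (d n)) (P : forall n, probability (Om n) R).
Variables (k : nat -> nat) (Z : forall n, 'I_(k n) -> {RV (P n) >-> (R * R)%type}).
Arguments Z : clear implicits.
Hypothesis k_ge2 : forall n, (2 <= k n)%N.
Hypothesis Z_dom : forall n i w, 0 < (Z n i w).2 /\ (Z n i w).2 <= (Z n i w).1.
Hypothesis Z_noteq : P n [set w | constant (sample (Z n) w)] @[n --> \oo] --> 0%E.
Variable rho : R -> R.
Hypothesis rhoC : class_C rho.
Variable alpha0 : R.
Hypothesis alpha0_gt0 : 0 < alpha0.
Variable sigma : nat -> R.
Hypothesis sigma_gt0 : forall n, 0 < sigma n.
Variables alpham alpha1 alphap : R.
Hypotheses (alpham_gt0 : 0 < alpham) (ltm1 : alpham < alpha1) (lt1p : alpha1 < alphap).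
Hypothesis alpha1E : alpha1 = varpi (rho 0) * alpha0.
Variable H : probability (R * R)%type R.
Hypothesis HE : frechet_welsch rho alpha0 1 H.
Hypothesis Z_cvg : forall f : R * R -> R, class_F1 alpham alphap f ->
    weak_cvg_cst P
      (fun n w => (k n)%:R^-1 *
         \sum_(i < k n) f ((Z n i w).1 / sigma n, (Z n i w).2 / sigma n))
      (\int[H]_(p in @pos_quadrant R) f p).
Variable rho_hat : forall n, {RV (P n) >-> R}.
Hypothesis rho_hat01 : forall n w, 0 <= rho_hat n w <= 1.
Hypothesis rho_hat_cvg : weak_cvg_cst P (fun n w => rho_hat n w) (rho 0).

Notation F := (prob_filter P).
Notation rho0 := (rho 0).
Notation em := (euler_mascheroni R).
Notation row t := (projT1 (t : {n : nat & Om n})).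
Notation smp t := (sample (Z (row t)) (projT2 t)).
Notation rsmp t := (rescale (sigma (row t)) (smp t)).

Let rho01 : 0 <= rho0 <= 1. Proof. exact: class_C_itv01. Qed.
Let alpha1_gt0 : 0 < alpha1. Proof. exact: lt_trans ltm1. Qed.

Let mZ n i : measurable_fun [set: Om n] (Z n i).
Proof. exact: measurable_funP. Qed.

Let adm n w : admissible (sample (Z n) w).
Proof. by apply: admissible_sample => i w'; exact: Z_dom. Qed.

Let radm t : admissible (rsmp t).
Proof. exact: admissible_rescale. Qed.

Let smp_gt0 t : (0 < size (smp t))%N.
Proof. exact: size_sample_gt0. Qed.

Let rsmp_gt0 t : (0 < size (rsmp t))%N.
Proof. by rewrite size_map. Qed.

Lemma near_not_constant : \forall t \near F, ~~ constant (smp t).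
Proof.
exists (fun n => [set w | ~~ constant (sample (Z n) w)]).
have mC n : measurable [set w | constant (sample (Z n) w)].
  exact: (measurable_constant_sample (k_ge2 n) (mZ (n := n)) (sigma_gt0 n)).
have E n : ~` [set w | ~~ constant (sample (Z n) w)] = [set w | constant (sample (Z n) w)].
  by apply/seteqP; split => w /=; [move/negP; rewrite negbK|move=> ->].
split.
- by move=> n; rewrite -[X in measurable X]setCK E; exact: measurableC.
- by [].
- by under eq_fun do rewrite E.
Qed.

Lemma emp_cvg f : class_F1 alpham alphap f ->
  emp f (rsmp t) @[t --> F] --> \int[H]_(p in @pos_quadrant R) f p.
Proof.
move=> /Z_cvg /weak_cvg_cst_prob; apply: cvg_trans.
by apply: near_eq_cvg; apply: nearW => -[n w] /=; rewrite emp_sample.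
Qed.

Lemma emp_powR_cvg a : alpham < a < alphap ->
  emp_powR a (rsmp t) @[t --> F] --> Upsilon rho0 (a / alpha0).
Proof.
move=> am; have a0 : 0 < a by case/andP: am => am _; exact: lt_trans am.
rewrite -(population_powR rhoC alpha0_gt0 HE a0); apply: emp_cvg.
by left; right; exists a.
Qed.

Lemma emp_powR_ln_cvg a : alpham < a < alphap ->
  emp_powR_ln a (rsmp t) @[t --> F] --> - Upsilon_ln rho0 (a / alpha0) / alpha0.
Proof.
move=> am; have a0 : 0 < a by case/andP: am => am _; exact: lt_trans am.
rewrite -(population_powR_ln rhoC alpha0_gt0 HE a0); apply: emp_cvg.
by right; exists a.
Qed.

Lemma emp_ln_cvg : emp_ln (rsmp t) @[t --> F] --> (2 * em - rho0) / alpha0.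
Proof.
rewrite (_ : (2 * em - rho0) / alpha0 = em / alpha0 + - (rho0 - em) / alpha0); last by ring.
rewrite -(population_ln_fst alpha0_gt0 HE) -(population_ln_snd rhoC alpha0_gt0 HE).
by apply: cvgD; apply: emp_cvg; left; left; [left|right].
Qed.

(** The logarithms contribute the summand rho0 / 2 - gamma of Pi, and the ratio of the
    power means its logarithmic derivative of Upsilon. *)
Lemma score_cvg a : alpham < a < alphap ->
  score a (rsmp t) @[t --> F] --> Pi_fun rho0 (a / alpha0) / alpha0.
Proof.
move=> am; have a0 : 0 < a by case/andP: am => am _; exact: lt_trans am.
have aa : 0 < a / alpha0 by rewrite divr_gt0.
have a1 : -1 < a / alpha0 by lra.
have u0 := Upsilon_gt0 rho01 a1.
rewrite Pi_funE// [X in _ --> X](_ : _ = a^-1 +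
  (- Upsilon_ln rho0 (a / alpha0) / alpha0) / Upsilon rho0 (a / alpha0) -
  (2 * em - rho0) / alpha0 / 2); last first.
  by move: u0; move: (Upsilon _ _) (Upsilon_ln _ _) => u v u0; field; rewrite !gt_eqF.
apply: cvgB; last by apply: cvgM; [exact: emp_ln_cvg|exact: cvg_cst].
apply: cvgD; first exact: cvg_cst.
apply: cvgM; first exact: emp_powR_ln_cvg.
by apply: cvgV; [rewrite gt_eqF|exact: emp_powR_cvg].
Qed.

(** A real-valued version of the shape estimator; on constant samples it takes an
    arbitrary positive value. *)
Definition alpha_fin n (w : Om n) : R :=
  if constant (sample (Z n) w) then 1 else (theta_hat (sample (Z n) w)).1.

Lemma alpha_fin_gt0 n (w : Om n) : 0 < alpha_fin w.
Proof.
rewrite /alpha_fin; case: ifPn => // zc.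
by have [] := theta_hatP zc (@adm _ _).
Qed.

(** The score is eventually positive slightly to the left of alpha1 and negative slightly
    to the right. *)
Lemma alpha_fin_cvg : alpha_fin (projT2 t) @[t --> F] --> alpha1.
Proof.
apply/cvgrPdist_lt => e e0.
have [h [h0 he hm hp]] : exists h,
    [/\ 0 < h, h <= e, h <= alpha1 - alpham & h <= alphap - alpha1].
  exists (Order.min e (Order.min (alpha1 - alpham) (alphap - alpha1))).
  by rewrite !lt_min e0 !subr_gt0 ltm1 lt1p !ge_min !lexx !orbT.
have [q1 q2 q3] := And3 alpham_gt0 ltm1 lt1p.
pose a := alpha1 - h / 2; pose b := alpha1 + h / 2.
have a0 : 0 < a by rewrite /a; lra.
have b0 : 0 < b by rewrite /b; lra.
have aam : alpham < a < alphap by rewrite /a; lra.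
have bam : alpham < b < alphap by rewrite /b; lra.
have E : alpha1 / alpha0 = varpi rho0 by rewrite alpha1E mulfK// gt_eqF.
have sa : \forall t \near F, 0 < score a (rsmp t).
  apply: (cvgr_gt _ (score_cvg aam)); rewrite divr_gt0// -varpi_gt ?divr_gt0//.
  by rewrite -E ltr_pM2r ?invr_gt0// /a; lra.
have sb : \forall t \near F, score b (rsmp t) < 0.
  apply: (cvgr_lt _ (score_cvg bam)); rewrite ltr_pdivrMr// mul0r -varpi_lt ?divr_gt0//.
  by rewrite -E ltr_pM2r ?invr_gt0// /b; lra.
near=> t.
have zc : ~~ constant (smp t) by near: t; exact: near_not_constant.
rewrite /alpha_fin ifN//.
have := theta_hat_gt (sigma_gt0 (projT1 t)) zc (@adm _ _) a0.
have -> : 0 < score a (rsmp t) by near: t.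
have := theta_hat_lt (sigma_gt0 (projT1 t)) zc (@adm _ _) b0.
have -> : score b (rsmp t) < 0 by near: t.
by rewrite ltr_distlC /a /b => h1 h2; apply/andP; split; lra.
Unshelve. all: by end_near. Qed.

(** The hypotheses concern fixed exponents only; convexity in the exponent squeezes the
    moment at the random exponent between quantities involving the fixed exponents
    alpha1 and alpha1 - h, alpha1 + h. *)
Lemma emp_powR_alpha_cvg :
  emp_powR (alpha_fin (projT2 t)) (rsmp t) @[t --> F] --> Upsilon rho0 (varpi rho0).
Proof.
have E : alpha1 / alpha0 = varpi rho0 by rewrite alpha1E mulfK// gt_eqF.
have [h [h0 hm hp]] : exists h,
    [/\ 0 < h, 2 * h <= alpha1 - alpham & 2 * h <= alphap - alpha1].
  exists (Order.min (alpha1 - alpham) (alphap - alpha1) / 2).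
  by rewrite divr_gt0 ?lt_min ?subr_gt0 ?ltm1// mulrC divfK// !ge_min !lexx !orbT.
have am : alpham < alpha1 < alphap by rewrite ltm1.
have [q1 q2 q3] := And3 alpham_gt0 ltm1 lt1p.
have ahm : alpham < alpha1 - h < alphap by lra.
have ahp : alpham < alpha1 + h < alphap by lra.
have d0 : alpha_fin (projT2 t) - alpha1 @[t --> F] --> 0.
  by rewrite -[X in _ --> X](subrr alpha1); apply: cvgB; [exact: alpha_fin_cvg|exact: cvg_cst].
have M1 := emp_powR_cvg am; rewrite E in M1.
apply: (@squeeze_cvgr _ _ _ _
  (fun t => emp_powR alpha1 (rsmp t) -
     (alpha_fin (projT2 t) - alpha1) * emp_powR_ln alpha1 (rsmp t))
  (fun t => emp_powR alpha1 (rsmp t) + `|alpha_fin (projT2 t) - alpha1| / h *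
     (emp_powR (alpha1 + h) (rsmp t) + emp_powR (alpha1 - h) (rsmp t)))).
- near=> t; apply: emp_powR_bounds => //.
  rewrite distrC; near: t.
  by have /cvgrPdist_le := alpha_fin_cvg; apply.
- rewrite -[X in _ --> X]subr0; apply: cvgB => //.
  rewrite -[X in _ --> X](mul0r (- Upsilon_ln rho0 (alpha1 / alpha0) / alpha0)).
  by apply: cvgM => //; exact: emp_powR_ln_cvg.
- rewrite -[X in _ --> X]addr0; apply: cvgD => //.
  rewrite -[X in _ --> X](mul0r (Upsilon rho0 ((alpha1 + h) / alpha0) +
    Upsilon rho0 ((alpha1 - h) / alpha0))).
  apply: cvgM; last by apply: cvgD; exact: emp_powR_cvg.
  rewrite -[X in _ --> X](mul0r h^-1); apply: cvgM; last exact: cvg_cst.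
  by rewrite -[X in _ --> X](@normr0 _ R); exact: cvg_norm.
Unshelve. all: by end_near. Qed.

Let rh (t : {n : nat & Om n}) : R := rho_hat (projT1 t) (projT2 t).

Let rh01 t : 0 <= rh t <= 1. Proof. exact: rho_hat01. Qed.

Let rh_cvg : rh t @[t --> F] --> rho0.
Proof. exact: (weak_cvg_cst_prob rho_hat_cvg). Qed.

Lemma Pi_fun_hat_cvg a : 0 < a -> Pi_fun (rh t) a @[t --> F] --> Pi_fun rho0 a.
Proof.
move=> a0; have a1 : -1 < a by lra.
have E r : Pi_fun r a = a^-1 - (r * Gamma_ln (a + 2) + (1 - r) * Gamma_ln (a + 1)) /
    (r * Gamma_fun (a + 2) + (1 - r) * Gamma_fun (a + 1)) + r / 2 - em.
  exact: Pi_funE.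
rewrite E (funext (fun t => E (rh t))).
have r1 : 1 - rh t @[t --> F] --> 1 - rho0 by apply: cvgB => //; exact: cvg_cst.
have lin (x y : R) : rh t * x + (1 - rh t) * y @[t --> F] --> rho0 * x + (1 - rho0) * y.
  by apply: cvgD; apply: cvgM => //; exact: cvg_cst.
apply: cvgB; last exact: cvg_cst.
apply: cvgD; last by apply: cvgM => //; exact: cvg_cst.
apply: cvgB; first exact: cvg_cst.
apply: cvgM; first exact: lin.
apply: cvgV; last exact: lin.
by have := Upsilon_gt0 rho01 a1; rewrite /Upsilon => /lt0r_neq0.
Qed.

Lemma varpi_hat_cvg : varpi (rh t) @[t --> F] --> varpi rho0.
Proof.
have v0 := varpi_gt0 rho01.
apply/cvgrPdist_lt => e e0.
have [h [h0 he hv]] : exists h, [/\ 0 < h, h <= e & h <= varpi rho0].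
  by exists (Order.min e (varpi rho0)); rewrite lt_min e0 !ge_min !lexx orbT.
pose a := varpi rho0 - h / 2; pose b := varpi rho0 + h / 2.
have a0 : 0 < a by rewrite /a; lra.
have b0 : 0 < b by rewrite /b; lra.
have sa : \forall t \near F, 0 < Pi_fun (rh t) a.
  apply: (cvgr_gt _ (Pi_fun_hat_cvg a0)); rewrite -varpi_gt// /a; lra.
have sb : \forall t \near F, Pi_fun (rh t) b < 0.
  apply: (cvgr_lt _ (Pi_fun_hat_cvg b0)); rewrite -varpi_lt// /b; lra.
near=> t.
have : a < varpi (rh t) by rewrite varpi_gt//; near: t.
have : varpi (rh t) < b by rewrite varpi_lt//; near: t.
by rewrite ltr_distlC /a /b => h1 h2; apply/andP; split; lra.
Unshelve. all: by end_near. Qed.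

Lemma Upsilon_hat_cvg :
  Upsilon (rh t) (varpi (rh t)) @[t --> F] --> Upsilon rho0 (varpi rho0).
Proof.
have v0 := varpi_gt0 rho01.
have G c : 0 < c -> Gamma_fun (varpi (rh t) + c) @[t --> F] --> Gamma_fun (varpi rho0 + c).
  move=> c0; have vc : 0 < varpi rho0 + c by rewrite addr_gt0.
  apply: (continuous_cvg _ (is_derive1_continuous (is_derive_Gamma_fun vc))).
  by apply: cvgD; [exact: varpi_hat_cvg|exact: cvg_cst].
apply: cvgD; apply: cvgM => //; try exact: G.
by apply: cvgB => //; exact: cvg_cst.
Qed.

Definition alpha_tilde_fin n (w : Om n) : R := alpha_fin w / varpi (rho_hat n w).

Definition sigma_tilde_fin n (w : Om n) : R :=
  (Upsilon (rho_hat n w) (varpi (rho_hat n w)) /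
    emp_powR (alpha_fin w) (rescale (sigma n) (sample (Z n) w))) `^ (alpha_fin w)^-1.

Lemma estimatorsE n (w : Om n) : ~~ constant (sample (Z n) w) ->
  alpha_tilde (rho_hat n w) (sample (Z n) w) = (alpha_tilde_fin w)%:E /\
  sigma_tilde (rho_hat n w) (sample (Z n) w) / sigma n = sigma_tilde_fin w.
Proof.
move=> zc; have v0 := varpi_gt0 (@rho_hat01 n w).
have v1 : -1 < varpi (rho_hat n w) by lra.
have u0 := Upsilon_gt0 (@rho_hat01 n w) v1.
have [a0 _ sE] := theta_hat_rescale (sigma_gt0 n) zc (@adm n w).
have A0 := emp_powR_gt0 (theta_hat (sample (Z n) w)).1 (@rsmp_gt0 (existT _ n w)) (@radm (existT _ n w)).
split.
  rewrite /alpha_tilde /alpha_hat /alpha_tilde_fin /alpha_fin !ifN//.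
  by rewrite inver gt_eqF.
rewrite /sigma_tilde /sigma_hat /sigma_tilde_fin /alpha_hat /alpha_fin !ifN//.
rewrite inver gt_eqF//= mulrAC sE -powRM ?divr_ge0 ?(ltW A0) ?(ltW u0)//.
by congr (_ `^ _); field; rewrite gt_eqF.
Qed.

Lemma alpha_tilde_fin_cvg : alpha_tilde_fin (projT2 t) @[t --> F] --> alpha0.
Proof.
have v0 := varpi_gt0 rho01.
rewrite [X in _ --> X](_ : _ = alpha1 / varpi rho0); last first.
  by rewrite alpha1E; field; rewrite gt_eqF.
apply: cvgM; first exact: alpha_fin_cvg.
by apply: cvgV; [rewrite gt_eqF|exact: varpi_hat_cvg].
Qed.

Lemma sigma_tilde_fin_cvg : sigma_tilde_fin (projT2 t) @[t --> F] --> (1 : R).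
Proof.
have v0 := varpi_gt0 rho01.
have v1 : -1 < varpi rho0 by lra.
have u0 := Upsilon_gt0 rho01 v1.
have q1 : Upsilon (rh t) (varpi (rh t)) / emp_powR (alpha_fin (projT2 t)) (rsmp t)
    @[t --> F] --> (1 : R).
  rewrite -[X in _ --> X](divff (lt0r_neq0 u0)).
  apply: cvgM; first exact: Upsilon_hat_cvg.
  by apply: cvgV; [rewrite gt_eqF|exact: emp_powR_alpha_cvg].
have lim : expR ((alpha_fin (projT2 t))^-1 * ln (Upsilon (rh t) (varpi (rh t)) /
    emp_powR (alpha_fin (projT2 t)) (rsmp t))) @[t --> F] --> (1 : R).
  rewrite -[X in _ --> X](@expR0 R) -[X in _ --> expR X](mulr0 alpha1^-1).
  rewrite -[X in _ --> expR (_ * X)](@ln1 R).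
  apply: (continuous_cvg _ (@continuous_expR R _)); apply: cvgM.
    by apply: cvgV; [rewrite gt_eqF|exact: alpha_fin_cvg].
  exact: (continuous_cvg _ (continuous_ln ltr01)).
apply: cvg_trans lim; apply: near_eq_cvg; near=> t.
have U0 : 0 < Upsilon (rh t) (varpi (rh t)).
  by apply: Upsilon_gt0 => //; have := varpi_gt0 (rh01 t); lra.
have A0 := emp_powR_gt0 (alpha_fin (projT2 t)) (rsmp_gt0 t) (@radm t).
by rewrite -(powR_gt0E _ (divr_gt0 U0 A0)).
Unshelve. all: by end_near. Qed.

Lemma measurable_alpha_fin n : measurable_fun [set: Om n] (@alpha_fin n).
Proof.
have mC := measurable_constant_sample (k_ge2 n) (mZ (n := n)) (sigma_gt0 n).
pose C := [set w | constant (sample (Z n) w)].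
apply: measurable_fun_gt => b.
have [b0|b0] := leP b 0.
  rewrite (_ : [set w | _] = setT)//; apply/seteqP; split => // w _ /=.
  by apply: le_lt_trans b0 _; exact: alpha_fin_gt0.
pose S := [set w | 0 < score b (rescale (sigma n) (sample (Z n) w))].
have mS : measurable S.
  pose f w := emp_powR b (rescale (sigma n) (sample (Z n) w)) *
    (emp_ln (rescale (sigma n) (sample (Z n) w)) / 2 - b^-1).
  pose g w := emp_powR_ln b (rescale (sigma n) (sample (Z n) w)).
  rewrite (_ : S = [set w | f w < g w]).
    have mc (c : R) : measurable_fun [set: Om n] (fun=> c) by exact: measurable_cst.
    apply: measurable_lt_set; last exact: measurable_emp_powR_ln.
    apply: measurable_funM; first exact: measurable_emp_powR.
    apply: measurable_funB => //; apply: measurable_funM => //.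
    exact: measurable_emp_ln.
  suff E w : (0 < score b (rescale (sigma n) (sample (Z n) w))) = (f w < g w).
    by apply/seteqP; split => w; rewrite /S /= E.
  have A0 := emp_powR_gt0 b (@rsmp_gt0 (existT _ n w)) (@radm (existT _ n w)).
  rewrite /= in A0; rewrite -[RHS]subr_gt0 -[LHS](pmulr_lgt0 _ A0).
  rewrite [X in (0 < X) = _](_ : _ = g w - f w)//.
  rewrite /score /f /g; move: A0; move: (b^-1) (emp_powR _ _) => bi A A0.
  by field; rewrite gt_eqF.
(* [alpha_fin] is 1 on constant samples *)
rewrite (_ : [set w | _] = (C `&` (if b < 1 then setT else set0)) `|` (~` C `&` S)).
  apply: measurableU; apply: measurableI => //; last exact: measurableC.
  by case: ifP.
apply/seteqP; split => w /=; rewrite /alpha_fin /C /S /=.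
  case: ifPn => [zc b1|zc]; first by left; rewrite b1.
  by rewrite (theta_hat_gt (sigma_gt0 n) zc (@adm n w) b0) => bt; right.
case=> -[zc]; first by rewrite zc; case: ifP.
by move/negP: zc => zc; rewrite ifN// (theta_hat_gt (sigma_gt0 n) zc (@adm n w) b0).
Qed.

Let rh_gt0 n w : 0 < varpi (rho_hat n w). Proof. exact: varpi_gt0. Qed.

Let mrh n : measurable_fun [set: Om n] (rho_hat n).
Proof. exact: measurable_funP. Qed.

Let mvarpi n : measurable_fun [set: Om n] (fun w => varpi (rho_hat n w)).
Proof. exact: measurable_varpi (@rho_hat01 n) (@mrh n). Qed.

Lemma measurable_alpha_tilde_fin n : measurable_fun [set: Om n] (@alpha_tilde_fin n).
Proof.
apply: measurable_funM; first exact: measurable_alpha_fin.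
exact: measurable_funV_gt0.
Qed.

Lemma measurable_sigma_tilde_fin n : measurable_fun [set: Om n] (@sigma_tilde_fin n).
Proof.
have U0 w : 0 < Upsilon (rho_hat n w) (varpi (rho_hat n w)).
  by apply: Upsilon_gt0 => //; have := rh_gt0 w; lra.
have A0 (w : Om n) : 0 < emp_powR (alpha_fin w) (rescale (sigma n) (sample (Z n) w)).
  exact: (emp_powR_gt0 _ (@rsmp_gt0 (existT _ n w)) (@radm (existT _ n w))).
apply: measurable_powR_gt0.
- by move=> w; rewrite divr_gt0.
- apply: measurable_funM; first exact: measurable_Upsilon.
  apply: measurable_funV_gt0 => //.
  by apply: measurable_emp_powR => //; exact: measurable_alpha_fin.
- by apply: measurable_funV_gt0; [exact: alpha_fin_gt0|exact: measurable_alpha_fin].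
Qed.

(** On constant samples the shape estimator is infinite, elsewhere the pair is
    real-valued, and an open set is pulled back separately on the two events. *)
Lemma measurable_estimators n (U : set (\bar R * R)) : open U ->
  measurable ((fun w => (alpha_tilde (rho_hat n w) (sample (Z n) w),
    sigma_tilde (rho_hat n w) (sample (Z n) w) / sigma n)) @^-1` U).
Proof.
move=> oU.
have mC := measurable_constant_sample (k_ge2 n) (mZ (n := n)) (sigma_gt0 n).
pose C := [set w | constant (sample (Z n) w)].
pose i0 : 'I_(k n) := Ordinal (ltnW (k_ge2 n)).
pose V := [set p : R * R | U (p.1%:E, p.2)].
pose W := [set y : R | U (+oo%E, y)].
have c1 : continuous (fun p : R * R => (p.1%:E, p.2)).
  by move=> p; apply: cvg_EFin_pair; [exact: cvg_fst|exact: cvg_snd].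
have c2 : continuous (fun y : R => (+oo%E : \bar R, y)).
  move=> y; apply: (@cvg_pair _ _ _ (nbhs y) (nbhs (+oo%E : \bar R)) (nbhs y)
    _ _ _ (fun=> +oo%E) id); [exact: cvg_cst|exact: cvg_id].
have oV : open V by exact: (open_comp (fun p _ => c1 p) oU).
have oW : open W by exact: (open_comp (fun y _ => c2 y) oU).
rewrite (_ : _ @^-1` U = (C `&` [set w | W ((Z n i0 w).2 / sigma n)]) `|`
    (~` C `&` [set w | V (alpha_tilde_fin w, sigma_tilde_fin w)])).
  have mz : measurable_fun [set: Om n] (fun w => (Z n i0 w).2 / sigma n).
    apply: measurable_funM; last exact: measurable_cst.
    exact: measurableT_comp measurable_snd (mZ i0).
  apply: measurableU; apply: measurableI => //; last 2 first.
  - exact: measurableC.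
  - apply: measurable_open_pair => //; first exact: measurable_alpha_tilde_fin.
    exact: measurable_sigma_tilde_fin.
  rewrite -[X in measurable X]setTI; apply: mz => //; exact: open_measurable.
have cE w : constant (sample (Z n) w) ->
    (alpha_tilde (rho_hat n w) (sample (Z n) w),
     sigma_tilde (rho_hat n w) (sample (Z n) w) / sigma n) =
    (+oo%E, (Z n i0 w).2 / sigma n).
  move=> zc; rewrite /alpha_tilde /sigma_tilde /alpha_hat /sigma_hat zc.
  congr (_, _ / _).
    by rewrite inver gt_eqF// gt0_mulye// lte_fin invr_gt0.
  rewrite [X in fine X](_ : _ = 0%E) /= ?powRr0 ?mulr1//.
  move/(constantP (0, 0)) : zc => [x sx].
  have : Z n i0 w \in sample (Z n) w by apply: map_f; rewrite mem_enum.
  by rewrite sx; case: (size _) => //= m; rewrite inE mem_nseq => /orP[|/andP[_]] /eqP ->.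
apply/seteqP; split => w /=.
  have [zc|zc] := boolP (constant (sample (Z n) w)).
    by rewrite cE// => UW; left.
  by have [-> ->] := estimatorsE zc => UV; right; split => //; exact/negP.
case=> -[zc]; first by rewrite cE.
by move/negP : zc => zc; have [-> ->] := estimatorsE zc.
Qed.

(** Eventually the sample is not constant, and the estimators are real-valued. *)
Lemma estimators_cvg : (fun t => (alpha_tilde (rh t) (smp t),
    sigma_tilde (rh t) (smp t) / sigma (row t))) @ F --> (alpha0%:E, 1 : R).
Proof.
have lim : (fun t : {n : nat & Om n} => ((alpha_tilde_fin (projT2 t))%:E,
    sigma_tilde_fin (projT2 t))) @ F --> (alpha0%:E, 1 : R).
  exact: cvg_EFin_pair alpha_tilde_fin_cvg sigma_tilde_fin_cvg.
apply: cvg_trans lim; apply: near_eq_cvg; apply: filterS near_not_constant => t zc.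
by have [-> ->] := estimatorsE zc.
Qed.

End Consistency.

Theorem theorem3p9 (R : realType)
  (* one probability space per row of the triangular array *)
  (d : nat -> measure_display) (Om : forall n, measurableType (d n))
  (P : forall n, probability (Om n) R)
  (k : nat -> nat) (k_ge2 : forall n, (2 <= k n)%N) (k_oo : k @ \oo --> \oo)
  (Z : forall n, 'I_(k n) -> {RV (P n) >-> (R * R)%type})
  (Z_dom : forall n i w, 0 < (Z n i w).2 /\ (Z n i w).2 <= (Z n i w).1)
  (Z_noteq : P n [set w | constant (sample (Z n) w)] @[n --> \oo] --> 0%E)
  (rho : R -> R) (rhoC : class_C rho)
  (alpha0 : R) (alpha0_gt0 : 0 < alpha0)
  (sigma : nat -> R) (sigma_gt0 : forall n, 0 < sigma n)
  (alpham alpha1 alphap : R)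
  (alpham_gt0 : 0 < alpham) (ltm1 : alpham < alpha1) (lt1p : alpha1 < alphap)
  (alpha1E : alpha1 = varpi (rho 0) * alpha0)
  (H : probability (R * R)%type R) (HE : frechet_welsch rho alpha0 1 H)
  (Z_cvg : forall f : R * R -> R, class_F1 alpham alphap f ->
    weak_cvg_cst P
      (fun n w => (k n)%:R^-1 *
         \sum_(i < k n) f ((Z n i w).1 / sigma n, (Z n i w).2 / sigma n))
      (\int[H]_(p in @pos_quadrant R) f p))
  (rho_hat : forall n, {RV (P n) >-> R})
  (rho_hat01 : forall n w, 0 <= rho_hat n w <= 1)
  (rho_hat_cvg : weak_cvg_cst P (fun n w => rho_hat n w) (rho 0)) :
  weak_cvg_cst P
    (fun n w => (alpha_tilde (rho_hat n w) (sample (Z n) w),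
                 sigma_tilde (rho_hat n w) (sample (Z n) w) / sigma n))
    (alpha0%:E, 1).
Proof.
apply: prob_weak_cvg_cst.
- by move=> n U; apply: measurable_estimators.
- exact: (estimators_cvg k_ge2 Z_dom Z_noteq rhoC alpha0_gt0 sigma_gt0 alpham_gt0
    ltm1 lt1p alpha1E HE Z_cvg rho_hat01 rho_hat_cvg).
Qed.
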